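(* Let $R$ be a real closed field, $v$ a convex subgroup of $R$, $X\subset R^n$ a bounded semi-algebraic $\mathcal C^1$ manifold, and $f:X\to R^k$ a $\mathcal C^1$ semi-algebraic mapping. Then for any infinitesimal $z\in v$, the image $f(c_z(f))$ is $(k,v)$-thin, where $c_z(f)=\{x\in X\mid \nu(d_xf)<z\}$.
   Context: $R$ is a real closed field. A convex subgroup $v\subset R$ is an additive subgroup such that $tx+(1-t)y\in v$ for all $x,y\in v$, $t\in[0,1]$. An element $z\in R$ is infinitesimal if $|z|$ is smaller than every positive rational number. A subset of $R^n$ is bounded if it is contained in a ball $B^n(0,N)$ with $N\in\mathbb N$ (a natural number, not an arbitrary element of $R$). For a linear map $A$, the Rabier function is $\nu(A)=\inf_{\|\varphi\|=1}\|A^*\varphi\|$; for $A:R^n\to R^k$ with $n\ge k$ equivalently $\nu(A)=\inf\{|Av|: v\perp\ker A,\ |v|=1\}$. For positive $w\in R$, a semi-algebraic set $S\subset R^k$ of dimension $d$ is $w$-thin if for a generic orthogonal projection $\pi:R^k\to H$ onto a $d$-dimensional linear subspace $H$ (i.e. for all $H$ outside a semi-algebraic subset of lower dimension of the Grassmannian), $\pi(S)$ contains no open Euclidean ball of $H$ of radius $w$; $S$ is $v$-thin if it is $w$-thin for some positive $w\in v$. For an integer $j\ge\dim S$, $S$ is $(j,v)$-thin if it is $v$-thin or $\dim S<j$ (with $\dim\emptyset=-1$). *)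

(* Defs.v *)
From HB Require Import structures.
From mathcomp Require Import all_boot all_order all_algebra.
From mathcomp Require Import all_classical all_reals all_analysis.
From mathcomp Require mpoly.

Set Implicit Arguments.
Unset Strict Implicit.
Unset Printing Implicit Defensive.

Import Order.TTheory GRing.Theory Num.Theory.
Import numFieldNormedType.Exports.

Local Open Scope classical_set_scope.
Local Open Scope ring_scope.

Section SemiAlgebraic.
Variable R : rcfType.

Definition dotv n (u w : 'rV[R]_n) : R := \sum_(i < n) u ord0 i * w ord0 i.
Definition enorm n (u : 'rV[R]_n) : R := Num.sqrt (dotv u u).

Definition nat_bounded n (X : set 'rV[R]_n) : Prop :=
  exists N : nat, X `<=` [set x | enorm x < N%:R].

(** Semi-algebraic sets (BCR Def. 2.1.4): finite unions of finite
    intersections of sets {P = 0} or {P < 0}, P a polynomial in n variables.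
    An atom (P, true) means P = 0, (P, false) means P < 0. *)
Definition sa_atom_holds n (a : mpoly.mpoly n R * bool) (x : 'rV[R]_n) : bool :=
  let: (P, b) := a in
  let val := mpoly.meval (fun i => x ord0 i) P in
  if b then val == 0 else val < 0.

Definition sa_set n (S : set 'rV[R]_n) : Prop :=
  exists s : seq (seq (mpoly.mpoly n R * bool)),
    S = [set x | has (fun c => all (fun a => sa_atom_holds a x) c) s].

Definition sa_map n k (A : set 'rV[R]_n) (g : 'rV[R]_n -> 'rV[R]_k) : Prop :=
  sa_set ((fun x => row_mx x (g x)) @` A).

Definition C1_on n k (U : set 'rV[R]_n) (F : 'rV[R]_n -> 'rV[R]_k) : Prop :=
  open U /\ (forall x, U x -> differentiable F x) /\
  (forall x, U x -> {for x, continuous (fun y => lin1_mx ('d F y))}).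

Definition flat n (m : nat) : set 'rV[R]_n :=
  [set y | forall j : 'I_n, (m <= j)%N -> y ord0 j = 0].

Definition sa_chart n (X : set 'rV[R]_n) (m : nat) (x : 'rV[R]_n)
    (U : set 'rV[R]_n) (phi psi : 'rV[R]_n -> 'rV[R]_n) : Prop :=
  U x /\ sa_set U /\ C1_on U phi /\ sa_map U phi /\
  C1_on (phi @` U) psi /\ sa_map (phi @` U) psi /\
  (forall u, U u -> psi (phi u) = u) /\
  phi @` (X `&` U) = phi @` U `&` @flat n m.

Definition sa_C1_manifold n (X : set 'rV[R]_n) : Prop :=
  sa_set X /\
  exists m : nat, (m <= n)%N /\
    forall x, X x -> exists U phi psi, sa_chart X m x U phi psi.

(** tangent space T_x X (computed in a chart; independent of the chart) *)
Definition tangent n (X : set 'rV[R]_n) (x : 'rV[R]_n) : set 'rV[R]_n :=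
  [set w | exists m U phi psi, sa_chart X m x U phi psi /\ @flat n m ('d phi x w)].

Definition local_C1_ext n k (X : set 'rV[R]_n) (f : 'rV[R]_n -> 'rV[R]_k)
    (x : 'rV[R]_n) (U : set 'rV[R]_n) (F : 'rV[R]_n -> 'rV[R]_k) : Prop :=
  [/\ U x, C1_on U F & forall y, X y -> U y -> F y = f y].

Definition sa_C1_map n k (X : set 'rV[R]_n) (f : 'rV[R]_n -> 'rV[R]_k) : Prop :=
  sa_map X f /\ forall x, X x -> exists U F, local_C1_ext X f x U F.

(** nu(d_x f) < z, where d_x f : T_x X -> R^k is the restriction to T_x X of
    the derivative of a local C^1 extension F of f, and
    nu(A) = inf_{|phi| = 1} |A^* phi|, A^* phi being the vector u of T_x X
    with <u, w> = <phi, A w> for all w in T_x X. *)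
Definition rabier_lt n k (X : set 'rV[R]_n) (f : 'rV[R]_n -> 'rV[R]_k)
    (x : 'rV[R]_n) (z : R) : Prop :=
  exists U F, local_C1_ext X f x U F /\
  exists ph : 'rV[R]_k, enorm ph = 1 /\
  exists u : 'rV[R]_n,
    [/\ tangent X x u,
        (forall w, tangent X x w -> dotv u w = dotv ph ('d F x w)) &
        enorm u < z].

Definition crit_z n k (X : set 'rV[R]_n) (f : 'rV[R]_n -> 'rV[R]_k) (z : R)
  : set 'rV[R]_n := [set x | X x /\ rabier_lt X f x z].

Definition crit_image n k (X : set 'rV[R]_n) (f : 'rV[R]_n -> 'rV[R]_k) (z : R)
  : set 'rV[R]_k := f @` crit_z X f z.

(** dimension: dim S >= d iff some projection of S onto d of the coordinates
    has nonempty interior; dim S = d iff moreover no larger d' works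
    (dim of the empty set is -1: no d works). *)
Definition dim_ge k (S : set 'rV[R]_k) (d : nat) : Prop :=
  exists s : 'I_d -> 'I_k, injective s /\
    interior ((fun x => \row_(i < d) x ord0 (s i)) @` S) !=set0.

Definition is_dim k (S : set 'rV[R]_k) (d : nat) : Prop :=
  dim_ge S d /\ forall d', dim_ge S d' -> (d' <= d)%N.

Definition dim_lt k (S : set 'rV[R]_k) (j : nat) : Prop :=
  forall d, dim_ge S d -> (d < j)%N.

(** Grassmannian of d-planes H of R^k, each H encoded by the matrix of the
    orthogonal projection onto it (acting on row vectors); as a subset of
    'M_k = R^(k*k) via mxvec. *)
Definition grass k (d : nat) : set 'M[R]_k :=
  [set P | [/\ P^T = P, P *m P = P & \rank P = d]].

Definition mxset k (B : set 'M[R]_k) : set 'rV[R]_(k * k) := mxvec @` B.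

Definition proj_contains_ball k (S : set 'rV[R]_k) (P : 'M[R]_k) (w : R) : Prop :=
  exists c : 'rV[R]_k, c *m P = c /\
    forall y : 'rV[R]_k, y *m P = y -> enorm (y - c) < w ->
      exists s, S s /\ s *m P = y.

Definition w_thin k (S : set 'rV[R]_k) (w : R) : Prop :=
  forall d, is_dim S d ->
    exists B : set 'M[R]_k,
      [/\ B `<=` @grass k d, sa_set (mxset B),
          (forall e, dim_ge (mxset B) e ->
             exists e', dim_ge (mxset (@grass k d)) e' /\ (e < e')%N) &
          forall P, @grass k d P -> ~ B P -> ~ proj_contains_ball S P w].

Definition v_thin (v : set R) k (S : set 'rV[R]_k) : Prop :=
  exists w, [/\ v w, 0 < w & w_thin S w].

Definition jv_thin (v : set R) k (j : nat) (S : set 'rV[R]_k) : Prop :=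
  v_thin v S \/ dim_lt S j.

Definition convex_subgroup (v : set R) : Prop :=
  [/\ v 0, (forall x y, v x -> v y -> v (x - y)) &
      (forall x y t, v x -> v y -> 0 <= t <= 1 -> v (t * x + (1 - t) * y))].

Definition infinitesimal (z : R) : Prop :=
  forall q : rat, 0 < q -> `|z| < ratr q.

End SemiAlgebraic.

(* Main.v *)
Require Import Defs.
From HB Require Import structures.
From mathcomp Require Import all_boot all_order all_algebra.
From mathcomp Require Import all_classical all_reals all_analysis.
From mathcomp Require Import ring lra.
From mathcomp Require mpoly polyrcf ordered_qelim qe_rcf.

(** If x is z-critical with unit covector ph and |ph_j| >= 1/k, then moving f(x)
    by t in the direction e_j forces a displacement of order at least t/z in X.
    Quantifier elimination bounds uniformly the number of breakpoints of
    one-variable definable families. On a line of direction e_j, choose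
    definably a preimage g(t) of each image point that is critical for the
    index j. Near t+ some coordinate of g moves monotonically at speed of order
    1/z; as X is bounded by a natural number, each of the uniformly many
    intervals on which a given coordinate does so has length at most a natural
    multiple of z. Hence a grid of a large natural multiple of z as spacing meets
    the j-critical image in at most B points on each line of direction e_j, with
    B a natural number independent of the grid size. If the image contained a
    ball of radius a large multiple of z, a grid with more than kB points per
    side would be covered by the k sets of j-critical values: a contradiction by
    counting. *)

Set Implicit Arguments.
Unset Strict Implicit.
Unset Printing Implicit Defensive.

Import Order.TTheory GRing.Theory Num.Theory.
Import numFieldNormedType.Exports.

Local Open Scope ring_scope.

Module Ord := ordered_qelim.ord.

(** * Tame predicates on the line *)

Section Tame.
Variable R : rcfType.
Implicit Types (P Q : R -> Prop) (p : {poly R}) (s : seq R).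

(** A point of [s] may carry a truth value of its own, so that isolated points and open intervals
    are treated alike. *)
Definition breaks s P := forall x y, x <= y ->
  (forall c, c \in s -> ~~ (x <= c <= y)) -> (P x <-> P y).

Definition tame (D : nat) P := exists2 s, (size s <= D)%N & breaks s P.

Lemma tame_ext D P Q : (forall x, P x <-> Q x) -> tame D P -> tame D Q.
Proof.
move=> PQ [s sD sP]; exists s => // x y xy h.
by rewrite -!PQ; exact: sP.
Qed.

Lemma tame_not D P : tame D P -> tame D (fun x => ~ P x).
Proof.
move=> [s sD sP]; exists s => // x y xy h.
by have := sP x y xy h; tauto.
Qed.

Lemma tame_and D1 D2 P Q : tame D1 P -> tame D2 Q ->
  tame (D1 + D2) (fun x => P x /\ Q x).
Proof.
move=> [s sD sP] [r rD rQ]; exists (s ++ r); first by rewrite size_cat leq_add.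
move=> x y xy h.
have hP : P x <-> P y by apply: sP => // c cs; apply: h; rewrite mem_cat cs.
have hQ : Q x <-> Q y.
  by apply: rQ => // c cs; apply: h; rewrite mem_cat cs orbT.
tauto.
Qed.

(** By the intermediate value theorem the sign can change only at a root; the zero polynomial needs
    no breakpoint. *)
Lemma tame_poly (p : {poly R}) (u : R -> Prop) :
  tame (size p) (fun x => u (Num.sg p.[x])).
Proof.
have [->|p0] := eqVneq p 0.
  by exists [::]; rewrite ?size_poly0 // => x y _ _; rewrite !horner0.
set b := polyrcf.cauchy_bound p.
set s := polyrcf.roots p (- b) b.
exists s.
  apply: ltnW; apply: max_poly_roots => //; last exact: polyrcf.uniq_roots.
  by apply/allP => x; exact: polyrcf.root_roots.
move=> x y xy h.
suff -> : Num.sg p.[x] = Num.sg p.[y] by [].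
apply/eqP; rewrite -subr_eq0; apply: contraT => sgxy.
have pxy : p.[x] * p.[y] <= 0.
  rewrite leNgt; apply: contraNN sgxy => pos; rewrite subr_eq0.
  have [a0|a0|a0] := ltrgtP p.[x] 0.
  - by rewrite !ltr0_sg // -(nmulr_rgt0 _ a0).
  - by rewrite !gtr0_sg // -(pmulr_rgt0 _ a0).
  - by move: pos; rewrite a0 mul0r ltxx.
have [c cxy pc] := polyrcf.poly_ivt xy pxy.
have : c \in s.
  by rewrite polyrcf.in_roots pc p0 andbT /= polyrcf.root_in_cauchy_bound.
by move/h; move: cxy; rewrite in_itv /= => ->.
Qed.

End Tame.

(** * Quantifier elimination, uniform bounds on breakpoints, substitution *)

Section QuantifierElimination.
Variable R : rcfType.
Implicit Types (t : GRing.term R) (f : Ord.formula R) (e : seq R).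

Lemma qelim f : Ord.rformula f -> exists2 g,
  Ord.qf_form g && Ord.rformula g & forall e, Ord.holds e f <-> Ord.qf_eval e g.
Proof.
move=> rf.
have wf := @qe_rcf.wf_QE_wproj R.
exists (Ord.quantifier_elim (fun i bc => qe_rcf.qfr_to_formula (qe_rcf.wproj i bc)) f).
  exact: Ord.quantifier_elim_wf.
move=> e; have fP := @Ord.quantifier_elim_rformP R _ wf
  (fun i bc e => @qe_rcf.valid_QE_wproj R i bc e) e f rf.
by split=> /fP.
Qed.

(** The degree bound is read off from the term alone, whatever the values [e] of the other
    variables: the uniform bounds on breakpoints start here. *)
Lemma term_poly t i : GRing.rterm t -> exists D : nat, forall e,
  exists2 p : {poly R}, (size p <= D)%N &
    forall x, GRing.eval (set_nth 0 e i x) t = p.[x].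
Proof.
move=> rt; exists (size (qe_rcf.abstrX i (qe_rcf.to_rterm t))) => e.
exists (qe_rcf.eval_poly e (qe_rcf.abstrX i (qe_rcf.to_rterm t))).
  by rewrite qe_rcf.eval_polyP (leq_trans (size_Poly _)) // size_map.
by move=> x; rewrite qe_rcf.abstrXP qe_rcf.evalE qe_rcf.to_rtermE.
Qed.

Lemma term_tame t i (u : R -> Prop) : GRing.rterm t -> exists D : nat, forall e,
  tame D (fun x => u (Num.sg (GRing.eval (set_nth 0 e i x) t))).
Proof.
move=> /(term_poly i) [D hD]; exists D => e.
have [p pD pE] := hD e; have [s sD sP] := tame_poly p u.
exists s; first exact: leq_trans pD.
by move=> x y xy h; rewrite !pE; exact: sP.
Qed.

Lemma qf_tame f i : Ord.qf_form f && Ord.rformula f -> exists D : nat, forall e,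
  tame D (fun x => Ord.qf_eval (set_nth 0 e i x) f).
Proof.
elim: f => //=.
- by move=> b _; exists 0%N => e; exists [::].
- move=> t1 t2 /andP[r1 r2].
  have [|D h] := @term_tame (GRing.Add t1 (GRing.Opp t2)) i (fun x => x = 0).
    by rewrite /= r1.
  exists D => e; apply: tame_ext (h e) => x /=.
  by split=> [/eqP|/eqP ->]; rewrite ?subrr ?sgr0 // sgr_eq0 subr_eq0.
- move=> t1 t2 /andP[r1 r2].
  have [|D h] := @term_tame (GRing.Add t1 (GRing.Opp t2)) i (fun x => x = -1).
    by rewrite /= r1.
  exists D => e; apply: tame_ext (h e) => x /=; rewrite -subr_lt0 -sgr_cp0.
  by split=> [/eqP|/eqP].
- move=> t1 t2 /andP[r1 r2].
  have [|D h] := @term_tame (GRing.Add t1 (GRing.Opp t2)) i (fun x => x <= 0).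
    by rewrite /= r1.
  by exists D => e; apply: tame_ext (h e) => x /=; rewrite sgr_le0 subr_le0.
- move=> f1 h1 f2 h2 /andP[/andP[q1 q2] /andP[r1 r2]].
  have [|D1 t1] := h1; first by rewrite q1.
  have [|D2 t2] := h2; first by rewrite q2.
  exists (D1 + D2)%N => e; apply: tame_ext (tame_and (t1 e) (t2 e)) => x.
  by split=> [/andP|/andP].
- move=> f1 h1 f2 h2 /andP[/andP[q1 q2] /andP[r1 r2]].
  have [|D1 t1] := h1; first by rewrite q1.
  have [|D2 t2] := h2; first by rewrite q2.
  exists (D1 + D2)%N => e.
  apply: tame_ext (tame_not (tame_and (tame_not (t1 e)) (tame_not (t2 e)))) => x.
  by split=> [h|/orP]; [apply/orP; apply: contrapT|]; tauto.
- move=> f1 h1 f2 h2 /andP[/andP[q1 q2] /andP[r1 r2]].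
  have [|D1 t1] := h1; first by rewrite q1.
  have [|D2 t2] := h2; first by rewrite q2.
  exists (D1 + D2)%N => e.
  apply: tame_ext (tame_not (tame_and (t1 e) (tame_not (t2 e)))) => x.
  by split=> [h|/implyP]; [apply/implyP => ?; apply: contrapT|]; tauto.
- move=> f1 h1 /h1[D1 t1]; exists D1 => e.
  by apply: tame_ext (tame_not (t1 e)) => x; split=> /negP.
Qed.

(** Simultaneous substitution. Variables beyond the list become 0, in agreement with the default
    value of a short environment. *)
Fixpoint tsub (s : seq (GRing.term R)) t : GRing.term R :=
  match t with
  | GRing.Var i => nth (GRing.Const 0) s i
  | GRing.Const x => GRing.Const x
  | GRing.NatConst n => GRing.NatConst _ n
  | GRing.Add u v => GRing.Add (tsub s u) (tsub s v)
  | GRing.Opp u => GRing.Opp (tsub s u)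
  | GRing.NatMul u n => GRing.NatMul (tsub s u) n
  | GRing.Mul u v => GRing.Mul (tsub s u) (tsub s v)
  | GRing.Inv u => GRing.Inv (tsub s u)
  | GRing.Exp u n => GRing.Exp (tsub s u) n
  end.

Lemma eval_tsub e s t :
  GRing.eval e (tsub s t) = GRing.eval (map (GRing.eval e) s) t.
Proof.
elim: t => //=; try by move=> *; congruence.
move=> i; have [h|h] := ltnP i (size s); first by rewrite (nth_map (GRing.Const 0)).
by rewrite !nth_default ?size_map.
Qed.

Lemma rterm_tsub s t : all (@GRing.rterm R) s -> GRing.rterm t -> GRing.rterm (tsub s t).
Proof.
move=> /all_nthP hs; elim: t => //=.
- move=> i _; have [h|h] := ltnP i (size s); first exact: hs.
  by rewrite nth_default.
- by move=> t1 h1 t2 h2 /andP[/h1 -> /h2 ->].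
- by move=> t1 h1 t2 h2 /andP[/h1 -> /h2 ->].
Qed.

(** Meant for quantifier-free formulas: quantifiers are left untouched. *)
Fixpoint fsub (s : seq (GRing.term R)) f : Ord.formula R :=
  match f with
  | Ord.Equal u v => Ord.Equal (tsub s u) (tsub s v)
  | Ord.Lt u v => Ord.Lt (tsub s u) (tsub s v)
  | Ord.Le u v => Ord.Le (tsub s u) (tsub s v)
  | Ord.And g h => Ord.And (fsub s g) (fsub s h)
  | Ord.Or g h => Ord.Or (fsub s g) (fsub s h)
  | Ord.Implies g h => Ord.Implies (fsub s g) (fsub s h)
  | Ord.Not g => Ord.Not (fsub s g)
  | g => g
  end.

Lemma qf_eval_fsub e s f : Ord.qf_form f && Ord.rformula f ->
  Ord.qf_eval e (fsub s f) = Ord.qf_eval (map (GRing.eval e) s) f.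
Proof.
elim: f => //=; try by move=> *; rewrite !eval_tsub.
- by move=> g hg h hh /andP[/andP[? ?] /andP[? ?]]; rewrite hg ?hh //; apply/andP.
- by move=> g hg h hh /andP[/andP[? ?] /andP[? ?]]; rewrite hg ?hh //; apply/andP.
- by move=> g hg h hh /andP[/andP[? ?] /andP[? ?]]; rewrite hg ?hh //; apply/andP.
- by move=> g hg /hg ->.
Qed.

Lemma wf_fsub s f : all (@GRing.rterm R) s -> Ord.qf_form f && Ord.rformula f ->
  Ord.qf_form (fsub s f) && Ord.rformula (fsub s f).
Proof.
move=> rs; elim: f => //=.
- by move=> u v /andP[? ?]; rewrite !rterm_tsub.
- by move=> u v /andP[? ?]; rewrite !rterm_tsub.
- by move=> u v /andP[? ?]; rewrite !rterm_tsub.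
- move=> g hg h hh /andP[/andP[? ?] /andP[? ?]].
  by have /andP[-> ->] := hg ltac:(by apply/andP); apply: hh; apply/andP.
- move=> g hg h hh /andP[/andP[? ?] /andP[? ?]].
  by have /andP[-> ->] := hg ltac:(by apply/andP); apply: hh; apply/andP.
- move=> g hg h hh /andP[/andP[? ?] /andP[? ?]].
  by have /andP[-> ->] := hg ltac:(by apply/andP); apply: hh; apply/andP.
Qed.

End QuantifierElimination.

(** * Definable predicates *)

(** Parameters are encoded as environments of constant length [cdim]. The variable of index [cdim]
    is then fresh, and quantifying over it amounts to adding a scalar component to the context. *)
Class ctx (R : rcfType) (T : Type) := Ctx {
  cdim : nat;
  cenc : T -> seq R;
  size_cenc : forall x, size (cenc x) = cdim }.

Section Contexts.
Variable R : rcfType.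

Global Instance ctx_unit : ctx R unit := @Ctx R unit 0 (fun _ => [::]) (fun _ => erefl).

Lemma size_cenc_scalar T (C : ctx R T) (x : T * R) :
  size (rcons (cenc x.1) x.2) = (cdim (T := T)).+1.
Proof. by rewrite size_rcons size_cenc. Qed.

Global Instance ctx_scalar T (C : ctx R T) : ctx R (T * R) :=
  Ctx (size_cenc_scalar C).

Lemma size_cenc_vector T n (C : ctx R T) (x : T * 'rV[R]_n) :
  size (cenc x.1 ++ [seq x.2 ord0 i | i <- enum 'I_n]) = (cdim (T := T) + n)%N.
Proof. by rewrite size_cat size_cenc size_map size_enum_ord. Qed.

Global Instance ctx_vector T n (C : ctx R T) : ctx R (T * 'rV[R]_n) :=
  Ctx (@size_cenc_vector T n C).

End Contexts.

Section Definable.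
Variable R : rcfType.

Section Defs.
Context {T : Type} {C : ctx R T}.

Definition pol (F : T -> R) := exists2 t : GRing.term R,
  GRing.rterm t & forall x, F x = GRing.eval (cenc x) t.

Definition definable (P : T -> Prop) := exists2 f : Ord.formula R,
  Ord.rformula f & forall x, P x <-> Ord.holds (cenc x) f.

End Defs.

Definition polmap {T T'} {C : ctx R T} {C' : ctx R T'} (g : T -> T') :=
  exists2 s : seq (GRing.term R), all (@GRing.rterm R) s &
    forall x, cenc (g x) = map (GRing.eval (cenc x)) s.

(** Quantifiers are eliminated first, so that substituting terms cannot capture variables. *)
Lemma definable_comp {T T'} {C : ctx R T} {C' : ctx R T'} (g : T -> T') P :
  definable P -> polmap g -> definable (fun x => P (g x)).
Proof.
move=> [f rf fE] [s rs sE]; have [q wfq qE] := qelim rf.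
have /andP[q' r'] := wf_fsub rs wfq.
exists (fsub s q) => // x; rewrite fE qE sE -qf_eval_fsub //.
by split=> /(Ord.qf_evalP _ q').
Qed.

Section Closure.
Context {T : Type} {C : ctx R T}.
Implicit Types (F G : T -> R) (P Q : T -> Prop).

Lemma pol_const c : pol (fun _ : T => c).
Proof. by exists (GRing.Const c). Qed.

Lemma pol_add F G : pol F -> pol G -> pol (fun x => F x + G x).
Proof.
move=> [t rt tE] [u ru uE]; exists (GRing.Add t u); first exact/andP.
by move=> x; rewrite tE uE.
Qed.

Lemma pol_mul F G : pol F -> pol G -> pol (fun x => F x * G x).
Proof.
move=> [t rt tE] [u ru uE]; exists (GRing.Mul t u); first exact/andP.
by move=> x; rewrite tE uE.
Qed.

Lemma pol_opp F : pol F -> pol (fun x => - F x).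
Proof. by move=> [t rt tE]; exists (GRing.Opp t) => // x; rewrite tE. Qed.

Lemma pol_exp F m : pol F -> pol (fun x => F x ^+ m).
Proof. by move=> [t rt tE]; exists (GRing.Exp t m) => // x; rewrite tE. Qed.

Lemma pol_prod I (r : seq I) (F : I -> T -> R) :
  (forall i, pol (F i)) -> pol (fun x => \prod_(i <- r) F i x).
Proof.
move=> h; elim: r => [|i r ih].
  by rewrite (_ : (fun _ => _) = fun=> 1) ?funeqE => [|x]; [exact: pol_const|rewrite big_nil].
rewrite (_ : (fun _ => _) = fun x => F i x * \prod_(i <- r) F i x).
  exact: pol_mul.
by rewrite funeqE => x; rewrite big_cons.
Qed.

Lemma definable_ext P Q : (forall x, P x <-> Q x) -> definable P -> definable Q.
Proof. by move=> PQ [f rf fE]; exists f => // x; rewrite -PQ. Qed.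

Lemma definable_true : definable (fun=> True).
Proof. by exists (Ord.Bool true). Qed.

Lemma definable_eq F G : pol F -> pol G -> definable (fun x => F x = G x).
Proof.
move=> [t rt tE] [u ru uE]; exists (Ord.Equal t u); first exact/andP.
by move=> x; rewrite tE uE.
Qed.

Lemma definable_lt F G : pol F -> pol G -> definable (fun x => F x < G x).
Proof.
move=> [t rt tE] [u ru uE]; exists (Ord.Lt t u); first exact/andP.
by move=> x; rewrite tE uE.
Qed.

Lemma definable_le F G : pol F -> pol G -> definable (fun x => F x <= G x).
Proof.
move=> [t rt tE] [u ru uE]; exists (Ord.Le t u); first exact/andP.
by move=> x; rewrite tE uE.
Qed.

Lemma definable_not P : definable P -> definable (fun x => ~ P x).
Proof. by move=> [f rf fE]; exists (Ord.Not f) => // x /=; rewrite fE. Qed.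

Lemma definable_and P Q : definable P -> definable Q -> definable (fun x => P x /\ Q x).
Proof.
move=> [f rf fE] [g rg gE]; exists (Ord.And f g); first exact/andP.
by move=> x /=; rewrite fE gE.
Qed.

Lemma definable_or P Q : definable P -> definable Q -> definable (fun x => P x \/ Q x).
Proof.
move=> [f rf fE] [g rg gE]; exists (Ord.Or f g); first exact/andP.
by move=> x /=; rewrite fE gE.
Qed.

Lemma definable_imp P Q : definable P -> definable Q -> definable (fun x => P x -> Q x).
Proof.
move=> [f rf fE] [g rg gE]; exists (Ord.Implies f g); first exact/andP.
by move=> x /=; rewrite fE gE.
Qed.

Lemma set_nth_cenc (x : T) (c : R) : set_nth 0 (cenc x) cdim c = cenc (x, c).
Proof.
rewrite /= -(size_cenc x); elim: (cenc x) => //= a s ih.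
by rewrite -ih; case: s {ih}.
Qed.

Lemma definable_ex (P : T -> R -> Prop) :
  definable (fun x : T * R => P x.1 x.2) -> definable (fun x => exists c, P x c).
Proof.
move=> [f rf fE]; exists (Ord.Exists cdim f) => // x /=.
split=> -[c hc]; exists c.
  by rewrite set_nth_cenc; apply/fE.
by move: hc; rewrite set_nth_cenc => /fE.
Qed.

End Closure.

Section Quantifiers.
Context {T : Type} {C : ctx R T}.

Lemma definable_all (P : T -> R -> Prop) :
  definable (fun x : T * R => P x.1 x.2) -> definable (fun x => forall c, P x c).
Proof.
move=> dP; have := definable_not (definable_ex (P := fun x c => ~ P x c) (definable_not dP)).
by apply: definable_ext => x; split=> [h c|h [c]]; [apply: contrapT => hc; apply: h; exists c|].
Qed.

Lemma definable_exI n (P : 'I_n -> T -> Prop) :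
  (forall i, definable (P i)) -> definable (fun x => exists i, P i x).
Proof.
move=> h; apply: (definable_ext (P := fun x => exists2 i, i \in enum 'I_n & P i x)).
  by move=> x; split=> [[i _ ?]|[i ?]]; exists i; rewrite ?mem_enum.
elim: (enum _) => [|j s ih].
  apply: definable_ext (definable_not (definable_true (T := T))) => x.
  by split=> [/(_ I)|[]].
apply: definable_ext (definable_or (h j) ih) => x; split.
  by case=> [hj|[i iS hi]]; [exists j|exists i] => //; rewrite inE ?eqxx ?iS ?orbT.
by case=> i; rewrite inE => /orP[/eqP ->|iS] hi; [left|right; exists i].
Qed.

Lemma definable_allI n (P : 'I_n -> T -> Prop) :
  (forall i, definable (P i)) -> definable (fun x => forall i, P i x).
Proof.
move=> h; have := definable_not (definable_exI (fun i => definable_not (h i))).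
by apply: definable_ext => x; split=> [h' i|h' [i]]; [apply: contrapT => hc; apply: h'; exists i|].
Qed.

(** [D] comes before [x]: once quantifiers are eliminated, the number of breakpoints depends on the
    formula only. *)
Lemma definable_tame (P : T * R -> Prop) :
  definable P -> exists D, forall x, tame D (fun c => P (x, c)).
Proof.
move=> [f rf fE]; have [g wfg gE] := qelim rf.
have [D hD] := qf_tame cdim wfg; exists D => x.
by apply: tame_ext (hD (cenc x)) => c; rewrite set_nth_cenc fE gE.
Qed.

End Quantifiers.

Section Maps.
Context {T T' : Type} {C : ctx R T} {C' : ctx R T'}.

Lemma polmap_id : polmap (fun x : T => x).
Proof.
exists [seq GRing.Var _ i | i <- iota 0 (cdim (T := T))].
  by rewrite all_map; apply/allP.
move=> x; rewrite -map_comp -[LHS](mkseq_nth 0) size_cenc.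
exact: eq_map.
Qed.

Lemma polmap_fst (g : T -> T' * R) : polmap g -> polmap (fun x => (g x).1).
Proof.
move=> [s /(all_nthP (GRing.Const 0)) rs sE]; exists (take (@cdim R T' C') s).
  by apply/(all_nthP (GRing.Const 0)) => i; rewrite size_take_min leq_min => /andP[? ?];
    rewrite nth_take //; exact: rs.
move=> x; rewrite map_take -sE /= -cats1 take_cat size_cenc ltnn subnn take0 cats0.
by [].
Qed.

Lemma polmap_fstv n (g : T -> T' * 'rV[R]_n) :
  polmap g -> polmap (fun x => (g x).1).
Proof.
move=> [s /(all_nthP (GRing.Const 0)) rs sE]; exists (take (@cdim R T' C') s).
  by apply/(all_nthP (GRing.Const 0)) => i; rewrite size_take_min leq_min => /andP[? ?];
    rewrite nth_take //; exact: rs.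
by move=> x; rewrite map_take -sE /= take_cat size_cenc ltnn subnn take0 cats0.
Qed.

Lemma pol_snd (g : T -> T' * R) : polmap g -> pol (fun x => (g x).2).
Proof.
move=> [s /(all_nthP (GRing.Const 0)) rs sE]; exists (nth (GRing.Const 0) s (@cdim R T' C')).
  have [h|h] := ltnP (@cdim R T' C') (size s); first exact: rs.
  by rewrite nth_default.
move=> x; have sz : (@cdim R T' C' < size s)%N.
  by have := congr1 size (sE x); rewrite size_cenc size_map => <-.
by rewrite -(nth_map _ 0) // -sE /= nth_rcons size_cenc ltnn eqxx.
Qed.

Lemma pol_sndv n (g : T -> T' * 'rV[R]_n) (i : 'I_n) :
  polmap g -> pol (fun x => (g x).2 ord0 i).
Proof.
move=> [s /(all_nthP (GRing.Const 0)) rs sE].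
have sz (x : T) : (@cdim R T' C' + i < size s)%N.
  by have := congr1 size (sE x); rewrite size_cenc size_map => <-; rewrite /= ltn_add2l.
exists (nth (GRing.Const 0) s (@cdim R T' C' + i)).
  have [h|h] := ltnP (@cdim R T' C' + i) (size s); first exact: rs.
  by rewrite nth_default.
move=> x; rewrite -(nth_map _ 0) ?sz // -sE /= nth_cat size_cenc.
rewrite ltnNge leq_addr /= addKn (nth_map i) ?size_enum_ord //.
by rewrite nth_ord_enum.
Qed.

Lemma polmap_pair (g : T -> T') (F : T -> R) :
  polmap g -> pol F -> polmap (fun x => (g x, F x)).
Proof.
move=> [s rs sE] [t rt tE]; exists (rcons s t); first by rewrite all_rcons rt.
by move=> x; rewrite map_rcons -sE -tE.
Qed.

Lemma polmap_pairv n (g : T -> T') (F : T -> 'rV[R]_n) :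
  polmap g -> (forall i, pol (fun x => F x ord0 i)) ->
  polmap (fun x => (g x, F x)).
Proof.
move=> [s rs sE] h.
have /choice[t ht] : forall i, exists t, GRing.rterm t /\
    forall x, F x ord0 i = GRing.eval (cenc x) t.
  by move=> i; have [t ? ?] := h i; exists t.
exists (s ++ [seq t i | i <- enum 'I_n]).
  by rewrite all_cat rs all_map; apply/allP => i _ /=; have [] := ht i.
move=> x; rewrite map_cat -sE -map_comp /=; congr (_ ++ _).
by apply: eq_map => i /=; have [_ ->] := ht i.
Qed.

Lemma definable_scalar (P : T' -> R -> Prop) (g : T -> T') (F : T -> R) :
  definable (fun x : T' * R => P x.1 x.2) -> polmap g -> pol F ->
  definable (fun x => P (g x) (F x)).
Proof. by move=> dP pg pF; exact: (definable_comp dP (polmap_pair pg pF)). Qed.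

Lemma definable_vector n (P : T' -> 'rV[R]_n -> Prop) (g : T -> T')
    (F : T -> 'rV[R]_n) :
  definable (fun x : T' * 'rV[R]_n => P x.1 x.2) -> polmap g ->
  (forall i, pol (fun x => F x ord0 i)) -> definable (fun x => P (g x) (F x)).
Proof. by move=> dP pg pF; exact: (definable_comp dP (polmap_pairv pg pF)). Qed.

Lemma polmap_tt : polmap (fun _ : T => tt).
Proof. by exists [::]. Qed.

End Maps.

End Definable.

Ltac solve_pol := repeat lazymatch goal with
  | |- polmap (fun x => x) => exact: polmap_id
  | |- polmap (fun _ => tt) => exact: polmap_tt
  | |- polmap fst =>
      first [apply: (polmap_fst (g := fun x => x)) | apply: (polmap_fstv (g := fun x => x))]
  | |- pol snd => apply: (pol_snd (g := fun x => x))
  | |- polmap (fun x => (_, _)) =>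
      first [apply: polmap_pair | apply: polmap_pairv => [|?]]
  | |- polmap (fun x => (@?g x).1) =>
      first [apply: (polmap_fst (g := g)) | apply: (polmap_fstv (g := g))]
  | |- pol (fun x => (@?g x).2) => apply: (pol_snd (g := g))
  | |- pol (fun x => @fun_of_matrix _ _ _ (@?g x).2 _ _) =>
      apply: (pol_sndv (g := g))
  | |- pol (fun x => @?F x + @?G x) => apply: pol_add
  | |- pol (fun x => @?F x * @?G x) => apply: pol_mul
  | |- pol (fun x => - @?F x) => apply: pol_opp
  | |- pol _ => first [exact: pol_const | assumption]
  end.

(** * Quantification over vectors *)

Section VectorQuantifiers.
Variable R : rcfType.
Context {T : Type} {C : ctx R T}.

Lemma definable_exv n (P : T -> 'rV[R]_n -> Prop) :
  definable (fun x : T * 'rV[R]_n => P x.1 x.2) ->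
  definable (fun x => exists c, P x c).
Proof.
move=> dP.
(* The coordinates are quantified one after the other: at stage [r] the first [r] are free and the
   others are those of [x.2]. *)
have step r : (r <= n)%N -> definable (fun x : T * 'rV[R]_n =>
    exists2 c : 'rV[R]_n, (forall i : 'I_n, (r <= i)%N -> c ord0 i = x.2 ord0 i) & P x.1 c).
  elim: r => [_|r ih rn].
    apply: definable_ext dP => x; split=> [h|[c cE]]; first by exists x.2.
    by rewrite (_ : c = x.2) //; apply/rowP => i; rewrite cE.
  have dQ := ih (ltnW rn).
  pose upd (x : 'rV[R]_n) a : 'rV[R]_n := \row_i if i == r :> nat then a else x ord0 i.
  have pupd : polmap (fun x : T * 'rV[R]_n * R => (x.1.1, upd x.1.2 x.2)).
    apply: polmap_pairv => [|i]; first by solve_pol.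
    have [ir|ir] := eqVneq (i : nat) r.
      rewrite (_ : (fun _ => _) = fun x => x.2); first by solve_pol.
      by rewrite funeqE => x; rewrite mxE ir eqxx.
    rewrite (_ : (fun _ => _) = fun x : T * 'rV[R]_n * R => x.1.2 ord0 i); first by solve_pol.
    by rewrite funeqE => x; rewrite mxE (negbTE ir).
  apply: (definable_ext (P := fun x : T * 'rV[R]_n => exists a, exists2 c : 'rV[R]_n,
      (forall i : 'I_n, (r <= i)%N -> c ord0 i = upd x.2 a ord0 i) & P x.1 c)); last first.
    by apply: definable_ex; exact: (definable_comp dQ pupd).
  move=> x; split=> [[a [c cE Pc]]|[c cE Pc]].
    exists c => // i ri; rewrite cE ?(ltnW ri) // mxE.
    by rewrite gtn_eqF.
  exists (c ord0 (Ordinal rn)), c => // i; rewrite leq_eqVlt mxE => /orP[/eqP ri|ri].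
    by rewrite -ri eqxx; congr (c _ _); apply: val_inj.
  by rewrite gtn_eqF // cE.
have p0 : polmap (fun x : T => (x, 0 : 'rV[R]_n)).
  apply: polmap_pairv => [|i]; first by solve_pol.
  by under eq_fun do rewrite mxE; solve_pol.
apply: definable_ext (definable_comp (step n (leqnn n)) p0) => x.
split=> [[c _ h]|[c h]]; exists c => //=.
by move=> i; rewrite leqNgt ltn_ord.
Qed.

Lemma definable_allv n (P : T -> 'rV[R]_n -> Prop) :
  definable (fun x : T * 'rV[R]_n => P x.1 x.2) ->
  definable (fun x => forall c, P x c).
Proof.
move=> dP; have := definable_not (definable_exv (P := fun x c => ~ P x c) (definable_not dP)).
by apply: definable_ext => x; split=> [h c|h [c]]; [apply: contrapT => hc; apply: h; exists c|].
Qed.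

End VectorQuantifiers.

(** * Infima, choice and grids for tame predicates *)

Section TameLine.
Variable R : rcfType.
Implicit Types (A : R -> Prop) (s : seq R).

Lemma count_ltn (T : eqType) (r : seq T) (P Q : pred T) c : c \in r ->
  subpred P Q -> ~~ P c -> Q c -> (count P r < count Q r)%N.
Proof.
move=> cr PQ nP Qc.
rewrite (_ : count Q r = count P r + count (predI Q (predC P)) r)%N.
  rewrite -[X in (X < _)%N]addn0 ltn_add2l -has_count; apply/hasP.
  by exists c => //=; rewrite Qc.
rewrite -count_predUI [X in (_ + X)%N](_ : _ = 0%N) ?addn0.
  by apply: eq_count => x /=; case: (boolP (P x)) => [/PQ ->|]; rewrite ?andbT.
apply/eqP; rewrite -leqn0 leqNgt -has_count; apply/hasPn => x _ /=.
by case: (P x); rewrite ?andbF.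
Qed.

Lemma exists_gap s (a : R) :
  exists2 e, 0 < e & forall c, c \in s -> a < c -> a + e <= c.
Proof.
elim: s => [|b s [e e0 he]]; first by exists 1.
exists (if a < b then Num.min e (b - a) else e).
  by case: ifP => // ab; rewrite lt_min e0 subr_gt0.
move=> c; rewrite inE => /orP[/eqP ->|cs] ac.
  by rewrite ac -lerBrDl ge_min lexx orbT.
apply: le_trans (he c cs ac); rewrite lerD2l.
by case: ifP => // _; rewrite ge_min lexx.
Qed.

Lemma exists_last_le s (a : R) : (forall c, c \in s -> ~~ (c <= a)) \/
  exists2 c, (c \in s) && (c <= a) & forall c', c' \in s -> c' <= a -> c' <= c.
Proof.
elim: s => [|b s ih]; first by left.
have [ba|ab] := leP b a; last first.
  case: ih => [h|[c /andP[cs ca] h]]; [left|right].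
    by move=> c; rewrite inE => /orP[/eqP ->|/h //]; rewrite -ltNge.
  exists c; first by rewrite inE cs ca orbT.
  by move=> c'; rewrite inE => /orP[/eqP ->|/h //]; rewrite leNgt ab.
right; case: ih => [h|[c /andP[cs ca] h]].
  exists b; first by rewrite inE eqxx ba.
  by move=> c; rewrite inE => /orP[/eqP ->|/h /negbTE ->].
have [bc|cb] := leP b c.
  exists c; first by rewrite inE cs ca orbT.
  by move=> c'; rewrite inE => /orP[/eqP ->|/h h' /h'].
exists b; first by rewrite inE eqxx ba.
by move=> c'; rewrite inE => /orP[/eqP ->|/h h' /h' ] // /le_trans; apply; exact: ltW.
Qed.

Lemma tame_germ D A (a : R) : tame D A ->
  exists2 e, 0 < e & forall x y, a < x < a + e -> a < y < a + e -> (A x <-> A y).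
Proof.
move=> [s _ sA]; have [e e0 he] := exists_gap s a; exists e => //.
suff H x y : a < x < a + e -> a < y < a + e -> x <= y -> (A x <-> A y).
  move=> x y hx hy; have [xy|/ltW yx] := leP x y; first exact: H.
  by have := H y x hy hx yx; tauto.
move=> /andP[ax xe] /andP[ay ye] xy; apply: sA => // c cs.
apply/negP => /andP[xc cy]; have := he c cs (lt_le_trans ax xc).
by rewrite leNgt (le_lt_trans cy ye).
Qed.

Lemma tame_inf D A x0 L : tame D A -> A x0 -> (forall x, A x -> L <= x) ->
  exists2 a, (forall x, A x -> a <= x) &
    forall e, 0 < e -> exists2 x, A x & x < a + e.
Proof.
(* [R] need not be complete: the infimum comes from tameness, as the last breakpoint at or below a
   suitable point of [A]. *)
move=> [s _ sA] Ax0 AL.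
have [m] := ubnP (count (fun c => c <= x0) s).
elim: m x0 Ax0 => // m ih x0 Ax0 cm.
(* Descend to a point of [A] with as few breakpoints as possible at or below it. *)
have [[x1 [Ax1 lt1]]|nx] := pselect (exists x, A x /\
    (count (fun c => c <= x)%R s < count (fun c => c <= x0)%R s)%N).
  by apply: (ih x1) => //; rewrite -ltnS; apply: leq_trans cm; rewrite ltnS.
case: (exists_last_le s x0) => [h|[c /andP[cs cx0] hc]].
  have L0 : L <= x0 by exact: AL.
  (* Without a breakpoint at or below [x0], [A] would extend past its lower bound. *)
  have : A (L - 1).
    apply/(sA (L - 1) x0); rewrite ?(le_trans _ L0) ?gerBl ?ler01 //.
    by move=> c cs; rewrite (negbTE (h c cs)) andbF.
  by move/AL; lra.
exists c.
  move=> x Ax; rewrite leNgt; apply/negP => xc; apply: nx; exists x; split => //.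
  have sub : subpred (fun c => c <= x) (fun c => c <= x0).
    by move=> d /= dx; apply: le_trans dx (le_trans (ltW xc) cx0).
  by apply: (count_ltn cs sub) => //; rewrite -ltNge.
move=> e e0; have [Ac|nAc] := pselect (A c).
  by exists c => //; rewrite ltrDl.
have cx : c < x0.
  by rewrite lt_neqAle cx0 andbT; apply/eqP => cE; apply: nAc; rewrite cE.
have m1 : c < Num.min x0 (c + e / 2) by rewrite lt_min cx; lra.
exists (Num.min x0 (c + e / 2)); last first.
  by rewrite gt_min; apply/orP; right; lra.
apply/(sA _ x0) => //; first by rewrite ge_min lexx.
move=> d ds; apply/negP => /andP[d1 d2].
by have := hc d ds d2; rewrite leNgt (lt_le_trans m1 d1).
Qed.

Lemma tame_gt (a : R) : tame 1 (fun x => a < x).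
Proof.
exists [:: a] => // x y xy h; split=> [ax|ay]; first exact: lt_le_trans xy.
rewrite ltNge; apply/negP => xa.
by have := h a (mem_head _ _); rewrite xa ltW.
Qed.

(* The least element of A if there is one, else the midpoint of the leftmost
   interval of A. *)
Definition pick_in A (c : R) := A c /\ ((forall y : R, A y -> c <= y) \/
  exists a b : R, a < b /\ (c + c = a + b /\ ((forall y : R, A y -> a < y) /\
   ((forall y : R, a < y -> y < b -> A y) /\
   (forall b' : R, b < b' -> exists y : R, a < y /\ (y < b' /\ ~ A y)))))).

Lemma pick_in_uniq A c c' : pick_in A c -> pick_in A c' -> c = c'.
Proof.
(* A least element and a leftmost open interval exclude each other: the interval would contain
   points of [A] below [d]. *)
have mixed d d' : A d -> A d' -> (forall y, A y -> d <= y) ->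
   (exists a b : R, a < b /\ (d' + d' = a + b /\ ((forall y : R, A y -> a < y) /\
   ((forall y : R, a < y -> y < b -> A y) /\
   (forall b' : R, b < b' -> exists y : R, a < y /\ (y < b' /\ ~ A y)))))) -> False.
  move=> Ad Ad' dmin [a [b [ab [_ [aA [abA _]]]]]].
  have ad := aA d Ad.
  have m : a < (a + Num.min d b) / 2 /\ (a + Num.min d b) / 2 < d /\
    (a + Num.min d b) / 2 < b.
    by have [db|db] := leP d b; split; [|split| |split]; lra.
  by have := dmin _ (abA _ m.1 m.2.2); lra.
move=> [Ac hc] [Ac' hc']; case: hc hc' => [mc|hc] [mc'|hc'].
- by apply/eqP; rewrite eq_le mc // mc'.
- by case: (mixed _ _ Ac Ac' mc hc').
- by case: (mixed _ _ Ac' Ac mc' hc).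
(* If [a < a'], the interval starting at [a] contains points of [A] at or below [a'], where there
   are none. *)
have sideA a b a' b' : a < b -> a' < b' -> (forall y, A y -> a' < y) ->
    (forall y : R, a < y -> y < b -> A y) -> a' <= a.
  move=> ab a'b' a'A abA; rewrite leNgt; apply/negP => aa'.
  have [m1 [m2 m3]] : a < (a + Num.min a' b) / 2 /\
      (a + Num.min a' b) / 2 <= a' /\ (a + Num.min a' b) / 2 < b.
    by have [db|db] := leP a' b; split; [|split| |split]; lra.
  by have := a'A _ (abA _ m1 m3); lra.
have [a [b [ab [cE [aA [abA bmax]]]]]] := hc.
have [a' [b' [ab' [cE' [aA' [abA' bmax']]]]]] := hc'.
have aa : a = a'.
  by apply/eqP; rewrite eq_le (sideA a' b' a b) // (sideA a b a' b').
have bb : b = b'.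
  apply/eqP; rewrite eq_le !leNgt; apply/andP; split; apply/negP.
    by move/bmax' => [y [y1 [y2 []]]]; apply: abA; rewrite ?aa.
  by move/bmax => [y [y1 [y2 []]]]; apply: abA'; rewrite -?aa.
by move: cE cE'; rewrite aa bb; lra.
Qed.

(** If the infimum [a] is not in [A], tameness makes [A] hold on an interval starting at [a]. Its
    right end [b] is the infimum of the points after [a] outside [A]; such points exist since [A] is
    bounded, for instance [N + 1]. *)
Lemma pick_in_ex D A x0 N : tame D A -> A x0 -> (forall x, A x -> `|x| <= N) ->
  exists c, pick_in A c.
Proof.
move=> tA Ax0 bA.
have [a amin ainf] := tame_inf (L := - N) tA Ax0
  ltac:(by move=> x /bA; rewrite ler_norml => /andP[]).
have [Aa|nAa] := pselect (A a); first by exists a; split=> //; left.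
have aA y : A y -> a < y.
  by move=> Ay; rewrite lt_neqAle amin // andbT; apply/eqP => aE; apply: nAa; rewrite aE.
have [e e0 he] := tame_germ a tA.
have [x1 Ax1 x1e] := ainf e e0.
have right y : a < y < a + e -> A y by move=> hy; apply/(he y x1) => //; rewrite aA.
have tB := tame_and (tame_gt a) (tame_not tA).
have [b bmin binf] := tame_inf (x0 := N + 1) (L := a) tB
  ltac:(split; [have := aA _ Ax0; have := bA _ Ax0; rewrite ler_norml; lra
    | by move/bA; rewrite ler_norml; lra]) ltac:(by move=> x [/ltW]).
have ab : a < b.
  have [y [ay nAy] yb] := binf (e / 2) ltac:(lra).
  have : ~~ (y < a + e) by apply/negP => ye; apply: nAy; apply: right; rewrite ay.
  by rewrite -leNgt; lra.
have abA y : a < y -> y < b -> A y.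
  move=> ay yb; apply: contrapT => nAy.
  by have := bmin y (conj ay nAy); rewrite leNgt yb.
exists ((a + b) / 2); split; first by apply: abA; lra.
right; exists a, b; do ![split=> //]; first by lra.
move=> b' bb'; have [y [ay nAy] yb] := binf (b' - b) ltac:(lra).
by exists y; split=> //; split=> //; lra.
Qed.

Lemma common_eps (I : finType) (Q : I -> R -> Prop) :
  (forall i e e', 0 < e' -> e' <= e -> Q i e -> Q i e') ->
  (forall i, exists2 e, 0 < e & Q i e) ->
  exists2 e, 0 < e & forall i, Q i e.
Proof.
move=> Qmon Qex.
suff [e e0 he] : exists2 e, 0 < e & forall i, i \in enum I -> Q i e.
  by exists e => // i; apply: he; rewrite mem_enum.
elim: (enum I) => [|i s [e e0 he]]; first by exists 1.
have [e' e'0 he'] := Qex i; exists (Num.min e e'); first by rewrite lt_min e0.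
move=> j; rewrite inE => /orP[/eqP ->|js].
  by apply: Qmon he'; rewrite ?lt_min ?e0 // ge_min lexx orbT.
by apply: Qmon (he j js); rewrite ?lt_min ?e0 // ge_min lexx.
Qed.

(* Counting the breakpoints to the left of a point (those equal to it counted
   separately) separates the points of the grid lying in A. *)
Lemma grid_tame_card D A (h t0 : R) m : tame D A -> 0 < h ->
  (forall a b, a + h <= b -> ~ (forall x, a <= x <= b -> A x)) ->
  (#|[set i : 'I_m | `[< A (t0 + i%:R * h)%R >]]| <= (D + D).+1)%N.
Proof.
move=> [s sD sA] h0 short; pose t (i : 'I_m) := t0 + i%:R * h.
pose be (x : R) := (count (fun c => (c < x)%R) s + count (fun c => (c <= x)%R) s)%N.
have beD x : (be x < (D + D).+1)%N.
  by rewrite ltnS leq_add // (leq_trans (count_size _ _)).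
have tlt (i j : 'I_m) : (i < j)%N -> t i + h <= t j.
  move=> ij; rewrite /t -addrA lerD2l -{2}[h]mul1r -mulrDl ler_pM2r //.
  by rewrite natr1 ler_nat.
have beinc (i j : 'I_m) : A (t i) -> A (t j) -> (i < j)%N -> (be (t i) < be (t j))%N.
  move=> Ai Aj ij; have ltij : t i < t j by apply: lt_le_trans (tlt _ _ ij); rewrite ltrDl.
  have le1 : (count (fun c => (c < t i)%R) s <= count (fun c => (c < t j)%R) s)%N.
    by apply: sub_count => c /= /lt_trans; apply.
  have le2 : (count (fun c => (c <= t i)%R) s <= count (fun c => (c <= t j)%R) s)%N.
    by apply: sub_count => c /= /le_trans; apply; exact: ltW.
  (* Without a breakpoint between them, the two grid points would bound an interval inside [A] of
     length at least [h]. *)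
  have [c cs /andP[c1 c2]] : exists2 c, c \in s & t i <= c <= t j.
    apply: contrapT => nc; apply: (short (t i) (t j)); first exact: tlt.
    move=> x /andP[x1 x2]; apply/(sA (t i) x) => // c cs; apply/negP => /andP[c1 c2].
    by apply: nc; exists c => //; rewrite c1 (le_trans c2).
  (* A breakpoint equal to [t j] raises the second count, any other one the first. *)
  rewrite /be; move: c2; rewrite le_eqVlt => /orP[/eqP c2|c2].
    rewrite -addnS leq_add //; apply: (count_ltn cs) => //; last by rewrite c2.
      by move=> d /= /le_trans; apply; exact: ltW.
    by rewrite -ltNge c2.
  rewrite -addSn leq_add //.
  apply: (count_ltn cs) => //; last by rewrite -leNgt.
  by move=> d /= /lt_trans; apply.
rewrite -[X in (_ <= X)%N]card_ord.
pose F (i : 'I_m) : 'I_(D + D).+1 := Ordinal (beD (t i)).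
rewrite -(card_in_imset (f := F)); first exact: max_card.
move=> i j; rewrite !inE => Ai Aj /(congr1 val) /= eqb.
apply: val_inj; have [ij|ji|//] := ltngtP (i : nat) j.
- by have := beinc _ _ Ai Aj ij; rewrite eqb ltnn.
- by have := beinc _ _ Aj Ai ji; rewrite eqb ltnn.
Qed.

End TameLine.

(** * Definable choice and sections over a line *)

Section Choice.
Variable R : rcfType.
Context {T : Type} {C : ctx R T}.

Lemma definable_pick_in (P : T -> R -> Prop) :
  definable (fun x : T * R => P x.1 x.2) ->
  definable (fun x : T * R => pick_in (P x.1) x.2).
Proof.
move=> dP.
apply: definable_and; first by apply: (definable_scalar dP); solve_pol.
apply: definable_or.
  apply: definable_all; apply: definable_imp; first by apply: (definable_scalar dP); solve_pol.
  by apply: definable_le; solve_pol.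
apply: definable_ex; apply: definable_ex.
apply: definable_and; first by apply: definable_lt; solve_pol.
apply: definable_and; first by apply: definable_eq; solve_pol.
apply: definable_and.
  apply: definable_all; apply: definable_imp; first by apply: (definable_scalar dP); solve_pol.
  by apply: definable_lt; solve_pol.
apply: definable_and.
  apply: definable_all; apply: definable_imp; first by apply: definable_lt; solve_pol.
  apply: definable_imp; first by apply: definable_lt; solve_pol.
  by apply: (definable_scalar dP); solve_pol.
apply: definable_all; apply: definable_imp; first by apply: definable_lt; solve_pol.
apply: definable_ex; apply: definable_and; first by apply: definable_lt; solve_pol.
apply: definable_and; first by apply: definable_lt; solve_pol.
by apply: definable_not; apply: (definable_scalar dP); solve_pol.
Qed.

(** Coordinates are fixed one at a time by applying [pick_in] to the values still possible; tameness
    and the bound [N] ensure that there is something to pick. *)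
Lemma definable_choice n (P : T -> 'rV[R]_n -> Prop) (N : R) :
  definable (fun x : T * 'rV[R]_n => P x.1 x.2) ->
  (forall t x i, P t x -> `|x ord0 i| <= N) ->
  exists G : T -> 'rV[R]_n -> Prop,
  [/\ definable (fun x : T * 'rV[R]_n => G x.1 x.2),
      forall t x, G t x -> P t x,
      forall t x y, G t x -> G t y -> x = y &
      forall t, (exists x, P t x) -> exists x, G t x].
Proof.
move=> dP bP.
enough (H : forall r, (r <= n)%N -> exists G : T -> 'rV[R]_n -> Prop,
  [/\ definable (fun x : T * 'rV[R]_n => G x.1 x.2),
      forall t x, G t x -> P t x,
      forall t x y (i : 'I_n), (i < r)%N -> G t x -> G t y -> x ord0 i = y ord0 i &
      forall t, (exists x, P t x) -> exists x, G t x]).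
  have [G [dG GP Gu Gn]] := H n (leqnn n); exists G; split => // t x y Gx Gy.
  by apply/rowP => i; apply: (Gu t x y).
elim=> [_|r ih rn]; first by exists P; split.
have [G [dG GP Gu Gn]] := ih (ltnW rn); set i0 := Ordinal rn.
pose A t c := exists x, G t x /\ x ord0 i0 = c.
have dA : definable (fun x : T * R => A x.1 x.2).
  apply: definable_exv; apply: definable_and.
    by apply: (definable_vector dG) => [|?]; solve_pol.
  by apply: definable_eq; solve_pol.
exists (fun t x => G t x /\ pick_in (A t) (x ord0 i0)); split.
- apply: definable_and => //.
  apply: (definable_scalar (P := fun t c => pick_in (A t) c)); try solve_pol.
  exact: definable_pick_in.
- by move=> t x [/GP].
- move=> t x y i; rewrite ltnS leq_eqVlt => /orP[/eqP ir|ir] [Gx px] [Gy py].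
    by rewrite (_ : i = i0); [exact: pick_in_uniq px py|apply: val_inj].
  exact: Gu Gx Gy.
- move=> t /Gn [x Gx]; have [D tA] := definable_tame dA.
  have [||c [cA hc]] := @pick_in_ex R D (A t) (x ord0 i0) N (tA t).
  + by exists x.
  + by move=> _ [y [/GP/bP h <-]].
  by have [y [Gy yc]] := cA; exists y; split => //; rewrite yc.
Qed.

End Choice.

(** * Bounded definable sections over a line *)

Section Lines.
Variable R : rcfType.
Context {T : Type} {C : ctx R T}.
Variables (n : nat) (G : T -> R -> 'rV[R]_n -> Prop) (N L : R).
Hypothesis dG : definable (fun x : T * R * 'rV[R]_n => G x.1.1 x.1.2 x.2).
Hypothesis Gfun : forall p t x y, G p t x -> G p t y -> x = y.
Hypothesis Gbnd : forall p t x i, G p t x -> `|x ord0 i| <= N.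
Hypothesis L0 : 0 < L.

Let subG T' (C' : ctx R T') (g : T' -> T) (F : T' -> R) (x : T' -> 'rV[R]_n) :
  polmap g -> pol F -> (forall i, pol (fun u => x u ord0 i)) ->
  definable (fun u => G (g u) (F u) (x u)).
Proof.
move=> pg pF px.
exact: (definable_comp dG (polmap_pairv (polmap_pair pg pF) px)).
Qed.

Definition has_pt p t := exists x, G p t x.

(** In the application [s] is a sign and [L] the inverse of a natural multiple of [z]. Only steps
    that land on a point of the section are tested. *)
Definition grows i s p e t := exists x, G p t x /\
  forall t' x', t < t' -> t' < t + e -> G p t' x' ->
    L * (t' - t) <= s * (x' ord0 i - x ord0 i).

(** Here growth just after [t] is an empty condition, and no coordinate is singled out. *)
Definition last_pt p e t := has_pt p t /\ forall t', t < t' -> t' < t + e -> ~ has_pt p t'.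

Lemma definable_has_pt : definable (fun x : T * R => has_pt x.1 x.2).
Proof. by apply: definable_exv; apply: subG => [||?]; solve_pol. Qed.

Lemma definable_grows i s : definable (fun x : T * R * R => grows i s x.1.1 x.1.2 x.2).
Proof.
apply: definable_exv; apply: definable_and.
  by apply: subG => [||?]; solve_pol.
apply: definable_all; apply: definable_allv.
apply: definable_imp; first by apply: definable_lt; solve_pol.
apply: definable_imp; first by apply: definable_lt; solve_pol.
apply: definable_imp; first by apply: subG => [||?]; solve_pol.
by apply: definable_le; solve_pol.
Qed.

Lemma definable_last_pt : definable (fun x : T * R * R => last_pt x.1.1 x.1.2 x.2).
Proof.
apply: definable_and.
  by apply: (definable_scalar definable_has_pt); solve_pol.
apply: definable_all.
apply: definable_imp; first by apply: definable_lt; solve_pol.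
apply: definable_imp; first by apply: definable_lt; solve_pol.
by apply: definable_not; apply: (definable_scalar definable_has_pt); solve_pol.
Qed.

Lemma tame_above i s : exists D, forall p t0 (x : 'rV[R]_n),
  tame D (fun t => exists y, G p t y /\ L * (t - t0) <= s * (y ord0 i - x ord0 i)).
Proof.
have [|D tD] := @definable_tame R (T * R * 'rV[R]_n) _
  (fun u => exists y, G u.1.1.1 u.2 y /\
    L * (u.2 - u.1.1.2) <= s * (y ord0 i - u.1.2 ord0 i)).
  apply: definable_exv; apply: definable_and; first by apply: subG => [||?]; solve_pol.
  by apply: definable_le; solve_pol.
by exists D => p t0 x; exact: (tD (p, t0, x)).
Qed.

(* On an interval, growth of the section over each step of length less than e
   propagates to the whole interval: look at the infimum of the points where it
   fails. *)
Lemma grows_length i s p e a b : 0 < e -> `|s| = 1 -> a <= b ->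
  (forall t, a <= t <= b -> grows i s p e t) -> L * (b - a) <= N + N.
Proof.
move=> e0 s1 ab E.
have [xa [Ga ga]] := E a ltac:(by rewrite lexx).
have [xb [Gb gb]] := E b ltac:(by rewrite lexx andbT).
have bound : s * (xb ord0 i - xa ord0 i) <= N + N.
  apply: le_trans (ler_norm _) _; rewrite normrM s1 mul1r.
  by apply: le_trans (ler_normB _ _) _; rewrite lerD // (Gbnd i Ga, Gbnd i Gb).
apply: le_trans bound; apply: contrapT => /negP; rewrite -ltNge => bad.
have [D tD] := tame_above i s.
(* The points after [a] where growth from [a] fails. Being in the domain of the section is part of
   the condition, since points beyond [b] may occur. *)
have tA : exists D', tame D' (fun t => a < t /\ ((has_pt p t /\
    ~ exists y, G p t y /\ L * (t - a) <= s * (y ord0 i - xa ord0 i)))).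
  have [D' tD'] := definable_tame definable_has_pt.
  by eexists; exact: (tame_and (tame_gt a) (tame_and (tD' p) (tame_not (tD p a xa)))).
have [D' {}tA] := tA.
have ab' : a < b.
  rewrite lt_neqAle ab andbT; apply/eqP => eab; move: bad.
  by rewrite -eab in Gb *; rewrite (Gfun Ga Gb) !subrr !mulr0 ltxx.
have [u ulow uinf] := tame_inf (x0 := b) (L := a) tA
  ltac:(split=> //; split; [by exists xb
    | by move=> [y [Gy]]; rewrite (Gfun Gy Gb) leNgt bad]) ltac:(by move=> t [/ltW]).
have ua : a <= u.
  rewrite leNgt; apply/negP => ua; have [t [at_ _] tu] := uinf (a - u) ltac:(lra).
  by move: tu; lra.
(* From [c], steps shorter than [e] reach all points between [u] and [u + e / 2], while the bound
   from [a] still holds at [c]. *)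
pose c := Num.max a (u - e / 2).
have ac : a <= c by rewrite le_max lexx.
have uc : u - e / 2 <= c by rewrite le_max lexx orbT.
have cu : c <= u by rewrite ge_max ua; lra.
have ub : u <= b.
  by apply: ulow; split=> //; split; [exists xb|move=> [y [Gy]]; rewrite (Gfun Gy Gb) leNgt bad].
have [xc [Gc gc]] := E c ltac:(by rewrite ac (le_trans cu)).
have goodc : L * (c - a) <= s * (xc ord0 i - xa ord0 i).
  move: ac; rewrite le_eqVlt => /orP[/eqP eac|ac].
    by rewrite -eac in Gc *; rewrite (Gfun Ga Gc) !subrr !mulr0.
  apply: contrapT => nle.
  have : u <= c.
    apply: ulow; split=> //; split; first by exists xc.
    by move=> [y [Gy]]; rewrite (Gfun Gy Gc).
  by rewrite /c le_max => /orP[h|]; [move: ac; rewrite /c lt_max ltxx /=; lra|lra].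
have [t [at_ [[xt Gt] nt]] tu] := uinf (e / 2) ltac:(lra).
apply: (nt); exists xt; split=> //.
have ct : c <= t.
  by apply: le_trans cu _; apply: ulow; split=> //; split; [exists xt|
    move=> [y [Gy h]]; apply: nt; exists y].
move: ct; rewrite le_eqVlt => /orP[/eqP ct|ct].
  by rewrite -ct in Gt *; rewrite (Gfun Gt Gc).
have := gc t xt ct ltac:(lra) Gt; lra.
Qed.

(** The coordinate given by the expansion hypothesis may vary with [t']. Each of the finitely many
    predicates [up] is constant just after [t], so the coordinate and the sign found at one point
    serve for all. *)
Lemma grows_cover p d t : 0 < d -> has_pt p t ->
  (forall t' x x', G p t x -> G p t' x' -> t < t' -> t' < t + d ->
     exists i, L * (t' - t) <= `|x' ord0 i - x ord0 i|) ->
  exists2 e, 0 < e & last_pt p e t \/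
    exists i : 'I_n, exists b : bool, grows i ((-1) ^+ b) p e t.
Proof.
move=> d0 [x Gx] exp.
pose up (ib : 'I_n * bool) t' := exists y, G p t' y /\
  L * (t' - t) <= (-1) ^+ ib.2 * (y ord0 ib.1 - x ord0 ib.1).
pose same (A : R -> Prop) e := forall t1 t2, t < t1 < t + e -> t < t2 < t + e ->
  (A t1 <-> A t2).
have same_mon A e e' : 0 < e' -> e' <= e -> same A e -> same A e'.
  move=> _ ee h t1 t2 /andP[h1 h2] /andP[h3 h4].
  by apply: h; rewrite ?h1 ?h3 (lt_le_trans _ (_ : t + e' <= _)) // lerD2l.
have [D tD] := definable_tame definable_has_pt.
have [e1 e10 he1] := tame_germ t (tD p).
have [||e2 e20 he2] := @common_eps R _ (fun ib e => same (up ib) e).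
- by move=> ib; exact: same_mon.
- move=> ib; have [D' tD'] := tame_above ib.1 ((-1) ^+ ib.2).
  exact: (tame_germ t (tD' p t x)).
pose e := Num.min d (Num.min e1 e2).
have e0 : 0 < e by rewrite !lt_min d0 e10.
exists e => //.
have ed : e <= d by rewrite /e ge_min lexx.
have ee1 : e <= e1 by rewrite /e !ge_min lexx orbT.
have ee2 : e <= e2 by rewrite /e !ge_min lexx !orbT.
have [[t1 [t1l [t1r [x1 G1]]]]|none] :=
    pselect (exists t1, t < t1 /\ (t1 < t + e /\ has_pt p t1)); last first.
  left; split; first by exists x.
  by move=> t' h1 h2 h3; apply: none; exists t'.
right.
have [|i hi] := exp t1 x x1 Gx G1 t1l; first by lra.
exists i, (x1 ord0 i - x ord0 i < 0), x; split => // t' x' h1 h2 G'.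
have [y [Gy hy]] : up (i, x1 ord0 i - x ord0 i < 0) t'; last by rewrite (Gfun G' Gy).
apply/(he2 (i, x1 ord0 i - x ord0 i < 0) t1 t').
- by apply/andP; split=> //; lra.
- by apply/andP; split=> //; lra.
by exists x1; split => //=; rewrite -normrEsign.
Qed.

(** [B] is fixed before the parameter, the spacing and the size of the grid. The condition
    [N + N < L * h] makes every interval of growth shorter than [h]. *)
Lemma line_count : exists B : nat, forall p (d h t0 : R) m, 0 < d -> 0 < h -> N + N < L * h ->
  (forall t t' x x', G p t x -> G p t' x' -> t < t' -> t' < t + d ->
     exists i, L * (t' - t) <= `|x' ord0 i - x ord0 i|) ->
  (#|[set i : 'I_m | `[< has_pt p (t0 + i%:R * h)%R >]]| <= B)%N.
Proof.
have [D0 tD0] := definable_tame definable_last_pt.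
have /choice[D tD] : forall ib : 'I_n * bool, exists D, forall p e,
    tame D (grows ib.1 ((-1) ^+ ib.2) p e).
  move=> ib; have [D hD] := definable_tame (definable_grows ib.1 ((-1) ^+ ib.2)).
  by exists D => p e; exact: (hD (p, e)).
(* One term for each coordinate and sign; [None] stands for [last_pt]. *)
exists (\sum_(ib : option ('I_n * bool)) (if ib is Some j then (D j + D j).+1 else (D0 + D0).+1))%N.
move=> p d h t0 m d0 h0 hL exp.
pose Q t e := last_pt p e t \/ exists i : 'I_n, exists b : bool, grows i ((-1) ^+ b) p e t.
have Qmon t e e' : 0 < e' -> e' <= e -> Q t e -> Q t e'.
  move=> _ ee; have lt t' : t' < t + e' -> t' < t + e.
    by move=> /lt_le_trans; apply; rewrite lerD2l.
  case=> [[pt hn]|[i [b [x [Gx hx]]]]]; [left|right].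
    by split=> // t' h1 /lt; exact: hn.
  by exists i, b, x; split=> // t' x' h1 /lt; exact: hx.
(* The step [e] depends on the point; the grid being finite, one [e] serves for all its points. *)
have [||e e0 he] := @common_eps R 'I_m
  (fun i e => has_pt p (t0 + i%:R * h) -> Q (t0 + i%:R * h) e).
- by move=> i e e' e'0 ee hq /hq; exact: Qmon.
- move=> i; have [pt|npt] := pselect (has_pt p (t0 + i%:R * h)); last by exists 1.
  have [e e0 Qe] := grows_cover d0 pt (fun t' x x' Gx Gx' => exp _ _ _ _ Gx Gx').
  by exists e.
pose S (ib : option ('I_n * bool)) := [set i : 'I_m |
  `[< (if ib is Some j then grows j.1 ((-1) ^+ j.2) p e else last_pt p e)
      (t0 + i%:R * h)%R >]].
have sub : [set i : 'I_m | `[< has_pt p (t0 + i%:R * h)%R >]] \subset \bigcup_ib S ib.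
  apply/fintype.subsetP => i; rewrite !inE => /(he i)[hl|[j [b hg]]].
    by apply/finset.bigcupP; exists None => //; rewrite !inE.
  by apply/finset.bigcupP; exists (Some (j, b)) => //; rewrite !inE.
apply: leq_trans (subset_leq_card sub) _.
apply: leq_trans (_ : \sum_ib #|S ib| <= _)%N.
  elim/big_rec2: _ => [|ib B A _ ih]; first by rewrite cards0.
  by apply: leq_trans (leq_card_setU _ _) _; rewrite leq_add2l.
apply: leq_sum => -[[i b]|] _; rewrite /S.
  apply: (grid_tame_card _ _ (tD (i, b) p e) h0) => a b' ab E.
  have ab' : a <= b' by move: ab h0; lra.
  have len := grows_length e0 (normr_sign R b) ab' E.
  have : L * h <= L * (b' - a) by rewrite ler_pM2l // lerBrDl.
  by move: hL len; lra.
(* [last_pt] cannot hold on a whole interval: just after the left end there would be further points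
   of the section, which it forbids. *)
apply: (grid_tame_card _ _ (tD0 (p, e)) h0) => a b ab /= E.
have [_ none] := E a ltac:(by rewrite lexx /=; lra).
have [le1 le2] : Num.min ((a + b) / 2) (a + e / 2) <= (a + b) / 2 /\
  Num.min ((a + b) / 2) (a + e / 2) <= a + e / 2.
  by rewrite !ge_min !lexx orbT.
have gta : a < Num.min ((a + b) / 2) (a + e / 2) by rewrite lt_min; apply/andP; split; lra.
apply: (none _ gta); first by apply: le_lt_trans le2 _; rewrite ltrD2l; lra.
by have [] := E (Num.min ((a + b) / 2) (a + e / 2)) ltac:(
  apply/andP; split; [exact: ltW | apply: le_trans le1 _; lra]).
Qed.

End Lines.

(** * Double counting on a finite grid *)

Section Grid.
Local Open Scope nat_scope.

(* Double counting of the pairs (y, r) such that y with j-th coordinate r lies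
   in A j. *)
Lemma grid_cover_le k T B (A : 'I_k -> pred {ffun 'I_k -> 'I_T.+1}) :
  (forall y, exists j, A j y) ->
  (forall j y, #|[set r | A j [ffun i => if i == j then r else y i]]| <= B) ->
  T.+1 <= k * B.
Proof.
move=> cover line; pose Y : finType := {ffun 'I_k -> 'I_T.+1}.
pose upd j (y : Y) r : Y := [ffun i => if i == j then r else y i].
have cardA j : #|A j| * T.+1 <= #|Y| * B.
  pose P := [set yr : Y * 'I_T.+1 | A j (upd j yr.1 yr.2)].
  have cP : #|P| <= #|Y| * B.
    rewrite (_ : #|P| = \sum_(y : Y) #|[set r | A j (upd j y r)]|).
      by rewrite -sum_nat_const; apply: leq_sum => y _; exact: line.
    under eq_bigr do rewrite -sum1_card; rewrite -sum1_card.
    rewrite (pair_big_dep xpredT (fun y r => r \in [set r | A j (upd j y r)]) (fun _ _ => 1)) /=.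
    by apply: eq_bigl => -[y r]; rewrite !inE.
  apply: leq_trans cP.
  rewrite -[X in _ * X]card_ord -cardsT -[#|A j|]cardsE -cardsX.
  (* This involution exchanges [r] with the [j]-th coordinate of [y], and sends the product of [A j]
     with the set of indices into [P]. *)
  pose F (yr : Y * 'I_T.+1) := (upd j yr.1 yr.2, yr.1 j).
  have FK : cancel F F.
    move=> [y r]; rewrite /F /=; congr (_, _); last by rewrite ffunE eqxx.
    by apply/ffunP => i; rewrite !ffunE; case: eqP => [->|].
  rewrite -(card_imset _ (can_inj FK)); apply: subset_leq_card.
  apply/fintype.subsetP => -[y r]; rewrite !inE /= => /andP[Ay _].
  rewrite -(FK (y, r)) imset_f // inE /F /= (_ : upd j _ _ = y) //.
  by apply/ffunP => i; rewrite !ffunE; case: eqP => [->|].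
have Y0 : 0 < #|Y| by apply/card_gt0P; exists [ffun=> ord0].
have : #|Y| <= \sum_j #|A j|.
  rewrite -cardsT; apply: leq_trans (_ : #|\bigcup_j [set y | A j y]| <= _).
    apply: subset_leq_card; apply/fintype.subsetP => y _; have [j Aj] := cover y.
    by apply/finset.bigcupP; exists j => //; rewrite inE.
  elim/big_rec2: _ => [|j c S _ ih]; first by rewrite cards0.
  by apply: leq_trans (leq_card_setU _ _) _; rewrite cardsE leq_add2l.
rewrite -(leq_pmul2r (ltn0Sn T)) big_distrl /= => le1.
have le2 : \sum_j #|A j| * T.+1 <= k * (#|Y| * B).
  by rewrite -[k in X in _ <= X]card_ord -sum_nat_const; apply: leq_sum => j _.
have := leq_trans le1 le2.
by rewrite mulnCA leq_pmul2l.
Qed.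

End Grid.

(** * First-order expansion at critical points *)

Section Differential.
Variable R : rcfType.

Lemma diff_bound m n (F : 'rV[R]_m -> 'rV[R]_n) x : differentiable F x ->
  forall e, 0 < e -> exists2 d, 0 < d & forall y, `|y - x| < d ->
    `|F y - F x - 'd F x (y - x)| <= e * `|y - x|.
Proof.
move=> /diff_locally /eqaddoP dF e e0.
have /nbhs_normP[d /= d0 hd] := dF e e0.
exists d => // y yx; have := hd (y - x).
rewrite /ball_ /= sub0r normrN => /(_ yx).
rewrite (_ : (_ - _) (y - x) = F (y - x + x) - (F x + 'd F x (y - x))) //.
by rewrite subrK opprD addrA.
Qed.

Lemma near_ball m (U : set 'rV[R]_m) x : open U -> U x ->
  exists2 d, 0 < d & forall y, `|y - x| < d -> U y.
Proof.
move=> oU Ux; have /nbhs_normP[d /= d0 hd] := open_nbhs_nbhs (conj oU Ux).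
by exists d => // y yx; apply: hd; rewrite /ball_ /= distrC.
Qed.

Lemma diff_near_id m (F : 'rV[R]_m -> 'rV[R]_m) x (d : R) : 0 < d ->
  (forall y, `|y - x| < d -> F y = y) -> forall h, 'd F x h = h.
Proof.
move=> d0 hF h.
have Fx : F x = x by apply: hF; rewrite subrr normr0.
suff -> : 'd F x = idfun :> ('rV[R]_m -> 'rV[R]_m) by [].
apply: diff_unique; first by move=> y; exact: cvg_id.
apply/eqaddoP => e e0.
have nd : \forall y \near (0 : 'rV[R]_m), `|y| < d by exact: nbhs0_lt.
apply: filterS nd => y yd.
rewrite (_ : (_ - _) y = F (y + x) - (F x + y)) // hF ?addrK // Fx.
rewrite [x + y]addrC subrr normr0 mulr_ge0 //; exact: ltW.
Qed.

Lemma norm_coord m (x : 'rV[R]_m) i : `|x ord0 i| <= `|x|.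
Proof.
rewrite [leRHS]mx_normrE.
by apply: le_trans (le_bigmax _ _ (ord0, i)).
Qed.

Lemma norm_coord_lt m (x : 'rV[R]_m) d : 0 < d -> (forall i, `|x ord0 i| < d) -> `|x| < d.
Proof.
move=> d0 h; rewrite [ltLHS]mx_normrE; apply/bigmax_ltP; split=> // -[i j] _ /=.
by rewrite ord1.
Qed.

Lemma norm_attained m (x : 'rV[R]_m) : x != 0 -> exists i, `|x ord0 i| = `|x|.
Proof.
move=> x0; have [|[i j] /= h] := @mx_norm_neq0 R 1 m x.
  by rewrite -[mx_norm x]/`|x| normr_eq0.
by exists j; rewrite -[RHS]/(mx_norm x) h (ord1 i).
Qed.

Lemma dotv_bound m (u w : 'rV[R]_m) c : (forall i, `|u ord0 i| <= c) ->
  `|dotv u w| <= m%:R * c * `|w|.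
Proof.
move=> h; apply: le_trans (ler_norm_sum _ _ _) _.
apply: le_trans (_ : \sum_(i < m) c * `|w| <= _).
  by apply: ler_sum => i _; rewrite normrM ler_pM // norm_coord.
by rewrite sumr_const card_ord -mulrA mulr_natl.
Qed.

Lemma coord_le_enorm m (u : 'rV[R]_m) i : `|u ord0 i| <= enorm u.
Proof.
rewrite /enorm -sqrtr_sqr ler_sqrt; last by apply: sumr_ge0 => j _; rewrite -expr2 sqr_ge0.
by rewrite /dotv (bigD1 i) //= -expr2 lerDl sumr_ge0 // => j _; rewrite -expr2 sqr_ge0.
Qed.

Lemma dotvD m (u w w' : 'rV[R]_m) : dotv u (w + w') = dotv u w + dotv u w'.
Proof. by rewrite /dotv -big_split; apply: eq_bigr => i _; rewrite mxE mulrDr. Qed.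

Lemma dotv_delta m (u : 'rV[R]_m) j t : dotv u (t *: delta_mx ord0 j) = t * u ord0 j.
Proof.
rewrite /dotv (bigD1 j) //= big1 => [|i ij]; rewrite !mxE ?eqxx /=.
  by rewrite addr0 mulr1 mulrC.
by rewrite (negbTE ij) !mulr0.
Qed.

(** The squares of the coordinates sum to 1, and each square is at most the absolute value, since
    the latter is at most 1. *)
Lemma unit_coord k (ph : 'rV[R]_k) : enorm ph = 1 -> exists j, 1 <= k%:R * `|ph ord0 j|.
Proof.
move=> ph1; apply: contrapT => nj.
have k0 : (0 < k)%N.
  rewrite lt0n; apply/negP => /eqP k0; move: ph1; subst k.
  by rewrite /enorm /dotv big_ord0 sqrtr0 => /eqP; rewrite eq_sym oner_eq0.
have lt1 j : k%:R * `|ph ord0 j| < 1.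
  by rewrite ltNge; apply/negP => h; apply: nj; exists j.
have kp : 0 < k%:R :> R by rewrite ltr0n.
have k1 : 1 <= k%:R :> R by rewrite ler1n.
have dv : dotv ph ph = 1.
  have pos : 0 <= dotv ph ph by apply: sumr_ge0 => j _; rewrite -expr2 sqr_ge0.
  by rewrite -(sqr_sqrtr pos) -/(enorm ph) ph1 expr1n.
have : k%:R * dotv ph ph < \sum_(j < k) (1 : R).
  rewrite /dotv mulr_sumr; apply: ltr_sum => [|j _].
    by apply/hasP; exists (Ordinal k0); rewrite ?mem_index_enum.
  apply: le_lt_trans (ler_norm _) _; rewrite !normrM normr_nat mulrA.
  apply: le_lt_trans (lt1 j); rewrite ler_piMr ?mulr_ge0 ?ler0n //.
  by rewrite -ph1 coord_le_enorm.
by rewrite dv mulr1 sumr_const card_ord ltxx.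
Qed.

(* Near a point of X, X is approximated to first order by the tangent space at
   that point: w is the differential of the inverse chart applied to the
   displacement in the chart. *)
Lemma tangent_approx n (X : set 'rV[R]_n) x : sa_C1_manifold X -> X x ->
  forall e, 0 < e -> exists2 d, 0 < d & forall y, X y -> `|y - x| < d ->
    exists2 w, tangent X x w & `|y - x - w| <= e * `|y - x|.
Proof.
move=> [_ [m [mn charts]]] Xx e e0.
have [U [phi [psi ch]]] := charts x Xx.
have [Ux [_ [[oU [dphi _]] [_ [[oV [dpsi _]] [_ [psiK phiX]]]]]]] := ch.
have dphix := dphi x Ux.
have Vx : (phi @` U)%classic (phi x) by exists x.
have dpsix := dpsi _ Vx.
have [c c0 lip] := linear_lipschitz (diff_continuous dphix).
have [d1 d10 h1] := diff_bound dphix ltr01.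
have ce : 0 < e / (c + 1) by rewrite divr_gt0 // addr_gt0.
have [d2 d20 h2] := diff_bound dpsix ce.
have [d3 d30 h3] := near_ball oU Ux.
have [d4 d40 h4] := near_ball oV Vx.
(* [phi \o psi] is the identity near [phi x]; hence the differential of [psi] there maps flat
   vectors to tangent vectors. *)
have dd h : 'd phi x ('d psi (phi x) h) = h.
  have pK : psi (phi x) = x by exact: psiK.
  have dphi' : differentiable phi (psi (phi x)) by rewrite pK.
  have E := diff_comp dpsix dphi'.
  rewrite pK in E; have /= <- := congr1 (@^~ h) E.
  apply: (diff_near_id d40) => y /h4 [u Uu <-] /=.
  by rewrite psiK.
have flatX y : X y -> U y -> flat m (phi y).
  move=> Xy Uy; have : (phi @` U `&` @flat R n m)%classic (phi y).
    by rewrite -phiX; exists y.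
  by case.
exists (Num.min d1 (Num.min d3 (d2 / (c + 1)))).
  by rewrite !lt_min d10 d30 divr_gt0 // addr_gt0.
move=> y Xy; rewrite !lt_min => /andP[y1 /andP[y3 y2]].
have Uy := h3 y y3.
have lipy : `|phi y - phi x| <= (c + 1) * `|y - x|.
  rewrite -[phi y - phi x](subrK ('d phi x (y - x))).
  apply: le_trans (ler_normD _ _) _; rewrite addrC mulrDl.
  by apply: lerD; [exact: lip | exact: h1].
have py : `|phi y - phi x| < d2.
  by apply: le_lt_trans lipy _; rewrite mulrC -ltr_pdivlMr // addr_gt0.
exists ('d psi (phi x) (phi y - phi x)).
  exists m, U, phi, psi; split=> //.
  rewrite dd => i mi; rewrite !mxE.
  by rewrite (flatX y Xy Uy i mi) (flatX x Xx Ux i mi) subrr.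
have := h2 (phi y) py; rewrite !psiK // => h; apply: le_trans h _.
apply: le_trans (_ : e / (c + 1) * ((c + 1) * `|y - x|) <= _).
  by rewrite ler_pM2l.
by rewrite mulrA divfK // gt_eqF // addr_gt0.
Qed.

(** Pair the first-order expansion of [F] with [ph]. The displacement is tangent up to a small
    error, and on tangent vectors the pairing is the product with [u], of norm less than [z]. In
    [n.+1], [n] comes from that product and 1 from all errors together; [k] comes from the lower
    bound on a coordinate of [ph]. *)
Lemma rabier_expand n k (X : set 'rV[R]_n) (f : 'rV[R]_n -> 'rV[R]_k) x z :
  sa_C1_manifold X -> X x -> rabier_lt X f x z ->
  0 < z /\ exists j, exists2 d, 0 < d & forall y t, X y -> `|y - x| < d ->
    f y = f x + t *: delta_mx ord0 j -> `|t| <= k%:R * (n.+1%:R * z) * `|y - x|.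
Proof.
move=> mX Xx [U [F [[Ux [oU [dF _]] FE] [ph [ph1 [u [_ uE uz]]]]]]].
have u0 : 0 <= enorm u by exact: sqrtr_ge0.
have z0 : 0 < z by exact: le_lt_trans uz.
split=> //; have [j pj] := unit_coord ph1; exists j.
have dFx := dF x Ux.
have [c c0 lip] := linear_lipschitz (diff_continuous dFx).
(* [a] bounds the sum of the coefficients of the error terms, and [e] is chosen so that
   [e * a <= z]; the final 1 keeps [a] positive. *)
pose a := k%:R * (c + 1) + n%:R * z + 1.
have a0 : 0 < a.
  by rewrite /a ltr_wpDl // addr_ge0 // mulr_ge0 ?ler0n // ltW // addr_gt0.
pose e := Num.min 1 (z / a).
have e0 : 0 < e by rewrite lt_min ltr01 divr_gt0.
have ea : e * a <= z by rewrite -ler_pdivlMr // ge_min lexx orbT.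
have [d1 d10 h1] := diff_bound dFx e0.
have [d2 d20 h2] := tangent_approx mX Xx e0.
have [d3 d30 h3] := near_ball oU Ux.
exists (Num.min d1 (Num.min d2 d3)); first by rewrite !lt_min d10 d20.
move=> y t Xy; rewrite !lt_min => /andP[y1 /andP[y2 y3]] fy.
have [w Tw hw] := h2 y Xy y2.
set r := `|y - x|.
have phb i : `|ph ord0 i| <= 1 by rewrite -ph1 coord_le_enorm.
have ub i : `|u ord0 i| <= z by apply: ltW; apply: le_lt_trans uz; exact: coord_le_enorm.
pose rem := F y - F x - 'd F x (y - x).
have Fdiff : F y - F x = t *: delta_mx ord0 j.
  by rewrite (FE y Xy (h3 y y3)) (FE x Xx Ux) fy addrC addKr.
(* [w] stands in for the displacement, because [uE] is known on tangent vectors only. *)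
have decomp : t * ph ord0 j = dotv u (y - x) + dotv u (w - (y - x)) +
    dotv ph ('d F x ((y - x) - w)) + dotv ph rem.
  rewrite -dotvD (_ : y - x + (w - (y - x)) = w); last by rewrite addrC subrK.
  rewrite uE // -!dotvD -raddfD (_ : w + (y - x - w) = y - x); last by rewrite addrC subrK.
  by rewrite /rem addrC subrK Fdiff dotv_delta.
have b1 : `|dotv u (y - x)| <= n%:R * z * r by exact: dotv_bound.
have b2 : `|dotv u (w - (y - x))| <= n%:R * z * (e * r).
  apply: le_trans (dotv_bound _ ub) _; rewrite ler_wpM2l //.
    by rewrite mulr_ge0 ?ler0n // ltW.
  by rewrite distrC.
have b3 : `|dotv ph ('d F x (y - x - w))| <= k%:R * (c * (e * r)).
  apply: le_trans (dotv_bound _ phb) _; rewrite mulr1 ler_wpM2l ?ler0n //.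
  by apply: le_trans (lip _) _; rewrite ler_pM2l.
have b4 : `|dotv ph rem| <= k%:R * (e * r).
  by apply: le_trans (dotv_bound _ phb) _; rewrite mulr1 ler_wpM2l ?ler0n // h1.
have tph : `|t * ph ord0 j| <= n.+1%:R * z * r.
  rewrite decomp; apply: le_trans (ler_normD _ _) _.
  have b12 := le_trans (ler_normD _ _) (lerD b1 b2).
  have b123 := le_trans (ler_normD _ _) (lerD b12 b3).
  apply: le_trans (lerD b123 b4) _.
  have r0 : 0 <= r by exact: normr_ge0.
  have : e * a * r <= z * r by rewrite ler_wpM2r.
  have : 0 <= e * r by rewrite mulr_ge0 // ltW.
  rewrite /a -natr1; nra.
rewrite normrM in tph.
apply: le_trans (_ : k%:R * (`|t| * `|ph ord0 j|) <= _).
  by rewrite mulrCA ler_peMr.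
by rewrite -[leRHS]mulrA ler_wpM2l ?ler0n.
Qed.

End Differential.

(** * Thinness of the critical image *)

Section Semialgebraic.
Variable R : rcfType.

Lemma pol_meval n (P : mpoly.mpoly n R) :
  pol (fun x : unit * 'rV[R]_n => mpoly.meval (fun i => x.2 ord0 i) P).
Proof.
elim/mpoly.mpolyind: P => [|c m p _ _ hp].
  by under eq_fun do rewrite mpoly.meval0; exact: pol_const.
under eq_fun do rewrite mpoly.mevalD mpoly.mevalZ mpoly.mevalX.
apply: pol_add => //; apply: pol_mul; first exact: pol_const.
by apply: pol_prod => i; apply: pol_exp; solve_pol.
Qed.

Lemma definable_sa n (S : set 'rV[R]_n) : sa_set S ->
  definable (fun x : unit * 'rV[R]_n => S x.2).
Proof.
move=> [s ->] /=; elim: s => [|c s ih] /=.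
  by apply: definable_ext (definable_not (definable_true (T := unit * 'rV[R]_n))) => x; split.
apply: (definable_ext (P := fun x : unit * 'rV[R]_n =>
  all (fun a => sa_atom_holds a x.2) c \/
  has (fun c => all (fun a => sa_atom_holds a x.2) c) s)).
  by move=> x; split=> /orP.
apply: definable_or => //; elim: c => [|[P b] c ihc] /=.
  by apply: definable_ext (definable_true (T := unit * 'rV[R]_n)).
apply: (definable_ext (P := fun x : unit * 'rV[R]_n =>
  sa_atom_holds (P, b) x.2 /\ all (fun a => sa_atom_holds a x.2) c)).
  by move=> x; split=> /andP.
apply: definable_and => //; case: b => /=.
  apply: (definable_ext (P := fun x : unit * 'rV[R]_n =>
    mpoly.meval (fun i => x.2 ord0 i) P = 0)); first by move=> x; split=> /eqP.
  by apply: definable_eq; [exact: pol_meval | exact: pol_const].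
by apply: definable_lt; [exact: pol_meval | exact: pol_const].
Qed.

(** The factor [k.+1], in place of the square root of [k], is natural and keeps the inequality
    strict even for [k = 0]. *)
Lemma enorm_lt k (u : 'rV[R]_k) a : 0 < a -> (forall i, `|u ord0 i| <= a) ->
  enorm u < k.+1%:R * a.
Proof.
move=> a0 h; have b0 : 0 < k.+1%:R * a by rewrite mulr_gt0.
rewrite -[ltRHS]gtr0_norm // -sqrtr_sqr ltr_sqrt ?exprn_gt0 //.
apply: le_lt_trans (_ : \sum_(i < k) a ^+ 2 < _).
  apply: ler_sum => i _; rewrite -expr2 -real_normK ?num_real //.
  by rewrite ler_pXn2r ?nnegrE ?normr_ge0 // ltW.
rewrite sumr_const card_ord exprMn -[X in X < _]mulr_natl ltr_pM2r ?exprn_gt0 //.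
by rewrite -natrX ltr_nat -mulnn mulSn leq_addr.
Qed.

End Semialgebraic.

Section ThinImage.
Variables (R : rcfType) (n k : nat) (X : set 'rV[R]_n) (f : 'rV[R]_n -> 'rV[R]_k).
Variables (z : R) (N : nat).
Hypothesis bX : forall x, X x -> enorm x < N%:R.
Hypothesis mX : sa_C1_manifold X.
Hypothesis saf : sa_map X f.
Hypothesis z0 : 0 < z.

Let gr x y := X x /\ f x = y.
(** The constant of [rabier_expand], enlarged by [z] to stay positive when [k = 0]. *)
Let K := (k * n.+1).+1%:R * z.

Let K0 : 0 < K. Proof. by rewrite mulr_gt0. Qed.

Let definable_gr : definable (fun u : unit * 'rV[R]_n * 'rV[R]_k => gr u.1.2 u.2).
Proof.
have dS := definable_sa saf.
apply: (definable_ext (P := fun u : unit * 'rV[R]_n * 'rV[R]_k =>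
  ((fun x => row_mx x (f x)) @` X)%classic (row_mx u.1.2 u.2))).
  move=> [[[] x] y] /=; split=> [[x' Xx' /eq_row_mx[<- <-]]|[Xx <-]]; first by split.
  by exists x.
apply: (definable_vector (P := fun _ : unit => ((fun x => row_mx x (f x)) @` X)%classic)
  (g := fun=> tt) (F := fun u => row_mx u.1.2 u.2)) => // [|i]; first by solve_pol.
case: (split_ordP i) => j ->.
  by under eq_fun do rewrite row_mxEl; solve_pol.
by under eq_fun do rewrite row_mxEr; solve_pol.
Qed.

(* The definable counterpart of "x is critical, with a unit covector whose
   j-th coordinate is at least 1/k": moving f in direction j costs at least
   t/K in the source, up to distance d. *)
Definition expands j d (y : 'rV[R]_k) (x : 'rV[R]_n) := gr x y /\
  forall t x', 0 < t -> gr x' (y + t *: delta_mx ord0 j) ->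
    (forall i, - d < x' ord0 i - x ord0 i /\ x' ord0 i - x ord0 i < d) ->
    exists i, t <= K * (x' ord0 i - x ord0 i) \/ t <= - (K * (x' ord0 i - x ord0 i)).

Lemma expands_mon j d d' y x : d' <= d -> expands j d y x -> expands j d' y x.
Proof.
move=> dd [g h]; split=> // t x' t0 g' near; apply: (h t x') => // i.
by have [h1 h2] := near i; split; lra.
Qed.

Lemma definable_expands j :
  definable (fun u : unit * 'rV[R]_k * R * R * 'rV[R]_n =>
    expands j u.1.1.2 (u.1.1.1.2 + u.1.2 *: delta_mx ord0 j) u.2).
Proof.
have sub T (C : ctx R T) (x : T -> 'rV[R]_n) (y : T -> 'rV[R]_k) :
    (forall i, pol (fun u => x u ord0 i)) -> (forall i, pol (fun u => y u ord0 i)) ->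
    definable (fun u => gr (x u) (y u)).
  move=> px py; apply: (definable_comp (g := fun u => ((tt, x u), y u)) definable_gr).
  by solve_pol.
have py T (C : ctx R T) (y : T -> 'rV[R]_k) (t : T -> R) :
    (forall i, pol (fun u => y u ord0 i)) -> pol t ->
    forall i, pol (fun u => (y u + t u *: delta_mx ord0 j) ord0 i).
  move=> hy ht i.
  under eq_fun do rewrite !mxE.
  by apply: pol_add => //; apply: pol_mul => //; exact: pol_const.
apply: definable_and; first by apply: sub => [i|]; [|apply: (py) => [i|]]; solve_pol.
apply: definable_all; apply: definable_allv.
apply: definable_imp; first by apply: definable_lt; solve_pol.
apply: definable_imp.
  by apply: sub => [i|]; [|apply: (py) => [i|]; [apply: (py) => [i'|]|]]; solve_pol.
apply: definable_imp.
  by apply: definable_allI => i; apply: definable_and; apply: definable_lt; solve_pol.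
by apply: definable_exI => i; apply: definable_or; apply: definable_le; solve_pol.
Qed.

Lemma crit_expands y : crit_image X f z y ->
  exists j, exists2 d, 0 < d & exists x, expands j d y x.
Proof.
move=> [x [Xx cx] fx]; have [_ [j [d d0 hd]]] := rabier_expand mX Xx cx.
exists j, d => //; exists x; split=> // t x' t0 [Xx' fx'] near.
have := hd x' t Xx'; rewrite fx => /(_ _ fx'); rewrite gtr0_norm // => le.
have {}le : t <= K * `|x' - x|.
  apply: le_trans (le _) _.
    by apply: norm_coord_lt => // i; rewrite !mxE ltr_norml; apply/andP; exact: near.
  rewrite ler_wpM2r // /K mulrA -natrM ler_pM2r // ler_nat.
  exact: leqnSn.
have [E|ne] := eqVneq (x' - x) 0.
  by move: le; rewrite E normr0 mulr0 leNgt t0.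
(* The sup norm is attained at a coordinate, which gives the polynomial inequalities of
   [expands]. *)
have [i iE] := norm_attained ne; exists i.
move: le; rewrite -iE !mxE; case: (ler0P (x' ord0 i - x ord0 i)) => _.
  by rewrite mulrN; right.
by left.
Qed.

(** Apply [line_count] to a definable choice of expanding points, with [L] equal to [K^-1]. Both [y]
    and [d] are parameters, so one [B] serves for all grids. *)
Lemma crit_line_count j : exists B : nat, forall (y : 'rV[R]_k) d h m, 0 < d ->
  (N + N)%:R * K < h ->
  (#|[set i : 'I_m | `[< exists x,
      expands j d (y + (i%:R * h)%R *: delta_mx ord0 j)%R x >]]| <= B)%N.
Proof.
pose P (p : unit * 'rV[R]_k * R * R) := expands j p.1.2 (p.1.1.2 + p.2 *: delta_mx ord0 j).
have [G [dG GE Gu Gn]] := definable_choice (P := P) (N := N%:R) (definable_expands j)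
  (fun p x i hx => le_trans (coord_le_enorm x i) (ltW (bX hx.1.1))).
pose G' (p : unit * 'rV[R]_k * R) t x := G (p, t) x.
have L0 : 0 < K^-1 by rewrite invr_gt0.
have dG' : definable (fun u : unit * 'rV[R]_k * R * R * 'rV[R]_n => G' u.1.1 u.1.2 u.2).
  by apply: definable_ext dG => -[[p t] x].
have [B hB] := @line_count R _ _ n G' N%:R K^-1 dG'
  (fun p t x y => Gu (p, t) x y)
  (fun p t x i Gx => le_trans (coord_le_enorm x i) (ltW (bX (GE _ _ Gx).1.1))) L0.
exists B => y d h m d0 hh.
have h0 : 0 < h by apply: le_lt_trans hh; rewrite mulr_ge0 ?ler0n // ltW.
have hL : N%:R + N%:R < K^-1 * h by rewrite -natrD mulrC ltr_pdivlMr.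
(* For steps shorter than [K * d], either [x'] is within [d] of [x] and [expands] applies, or some
   coordinate has moved by at least [d], which is enough. *)
have le := hB ((tt, y), d) (K * d) h 0 m (mulr_gt0 K0 d0) h0 hL.
apply: leq_trans (le _); last first.
  move=> t t' x x' /GE /= [g1 h1] /GE /= [g2 _] tt' td.
  have t0 : 0 < t' - t by lra.
  have g2' : gr x' (y + t *: delta_mx ord0 j + (t' - t) *: delta_mx ord0 j).
    by rewrite -addrA -scalerDl [t + _]addrC subrK.
  have [near|far] := pselect (forall i,
      - d < x' ord0 i - x ord0 i /\ x' ord0 i - x ord0 i < d).
    have [i hi] := h1 _ _ t0 g2' near; exists i.
    rewrite mulrC ler_pdivrMr // [leRHS]mulrC.
    case: hi => /le_trans; apply; rewrite -?mulrN ler_pM2l ?ler_norm //.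
    by rewrite -normrN ler_norm.
  have [i hi] : exists i, d <= `|x' ord0 i - x ord0 i|.
    apply: contrapT => nfar; apply: far => i; apply/andP; rewrite -ltr_norml ltNge.
    by apply/negP => hi; apply: nfar; exists i.
  exists i; apply: le_trans hi; rewrite mulrC ler_pdivrMr // mulrC; lra.
apply: subset_leq_card; apply/fintype.subsetP => i; rewrite !inE => hx.
by have [x Gx] := Gn ((tt, y), d, i%:R * h) hx; exists x; rewrite /G' add0r.
Qed.

Lemma no_large_ball : exists2 W : nat, (0 < W)%N & forall c, ~ (forall y,
  enorm (y - c) < W%:R * z -> crit_image X f z y).
Proof.
have /choice[B hB] := crit_line_count.
(* With [T.+1] points per side, the covering bound will read [T < T]. *)
pose T := (k * \sum_j B j)%N.
(* This makes [h] the least natural multiple of [z] exceeding [(N + N) * K]. *)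
pose H := ((N + N) * (k * n.+1).+1).+1.
pose h := H%:R * z.
have h0 : 0 < h by rewrite mulr_gt0.
have hh : (N + N)%:R * K < h.
  by rewrite /K mulrA -natrM ltr_pM2r // ltr_nat.
(* The coordinates of [y r - c] are at most [T.+1 * h]; the factor [k.+1] passes to the Euclidean
   norm. *)
exists (k.+1 * (T.+1 * H))%N => // c ball.
pose y (r : {ffun 'I_k -> 'I_T.+1}) : 'rV[R]_k := c + \row_i ((r i)%:R * h).
have cy r : crit_image X f z (y r).
  apply: ball; rewrite /y addrC addKr 2!natrM -!mulrA; apply: enorm_lt.
    by rewrite mulr_gt0.
  move=> i; rewrite mxE ger0_norm; last by rewrite mulr_ge0 // ltW.
  by rewrite ler_pM2r // ler_nat ltnW.
(* The grid is finite: a single distance [d] suits all its points, each with its own direction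
   [j]. *)
have [||d d0 hd] := @common_eps R {ffun 'I_k -> 'I_T.+1}
  (fun r d => exists j, exists x, expands j d (y r) x).
- move=> r e e' _ ee [j [x hx]]; exists j, x; exact: expands_mon hx.
- by move=> r; have [j [d d0 [x hx]]] := crit_expands (cy r); exists d => //; exists j, x.
pose A j (r : {ffun 'I_k -> 'I_T.+1}) := `[< exists x, expands j d (y r) x >].
suff : (T < k * \sum_j B j)%N by rewrite ltnn.
apply: (@grid_cover_le _ _ _ A) => [r|j r].
  by have [j [x hx]] := hd r; exists j; apply/asboolP; exists x.
apply: leq_trans (_ : B j <= _)%N; last by rewrite (bigD1 j) //= leq_addr.
(* The first grid point on the line of direction [j] through [y r]. *)
pose r0 : 'rV[R]_k := c + \row_i (if i == j then 0 else (r i)%:R * h).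
apply: leq_trans (hB j r0 d h T.+1 d0 hh); apply: subset_leq_card.
apply/fintype.subsetP => i hi.
have /asboolP[x hx] : A j [ffun l => if l == j then i else r l].
  by move: hi; rewrite inE.
rewrite !inE.
exists x; rewrite (_ : _ + _ = y [ffun l => if l == j then i else r l]) //.
rewrite /y /r0 -addrA; congr (_ + _); apply/rowP => l; rewrite !mxE ffunE.
by case: (eqVneq l j) => _ /=; rewrite ?mulr1 ?mulr0 ?add0r ?addr0.
Qed.

End ThinImage.

Section ConvexSubgroup.
Variables (R : rcfType) (v : set R).

Lemma convex_subgroup_natmul z m : convex_subgroup v -> v z -> v (m%:R * z).
Proof.
move=> [v0 vB _] vz; have vN : v (- z) by rewrite -[- z]sub0r; exact: vB.
elim: m => [|m ih]; first by rewrite mul0r.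
rewrite -natr1 mulrDl mul1r (_ : _ + z = m%:R * z - - z); first exact: vB.
by rewrite opprK.
Qed.

End ConvexSubgroup.

Theorem theorem3p2 (R : rcfType) (v : set R) (n k : nat)
    (X : set 'rV[R]_n) (f : 'rV[R]_n -> 'rV[R]_k) :
  convex_subgroup v ->
  nat_bounded X ->
  sa_C1_manifold X ->
  sa_C1_map X f ->
  forall z : R, v z -> infinitesimal z ->
    jv_thin v k (crit_image X f z).
Proof.
move=> cv [N bX] mX [saf _] z vz _.
(* Otherwise the image has dimension [k], and thinness concerns balls of the whole space. *)
have [small|big] := pselect (dim_lt (crit_image X f z) k); [by right|left].
have [d [dS kd]] : exists d, dim_ge (crit_image X f z) d /\ (k <= d)%N.
  apply: contrapT => nd; apply: big => d dS; rewrite ltnNge; apply/negP => kd.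
  by apply: nd; exists d.
(* The image has interior points, hence a critical point exists, which forces [z] to be positive. *)
have z0 : 0 < z.
  have [s [_ [u /interior_subset [_ [x [Xx cx] _] _]]]] := dS.
  by have [] := rabier_expand mX Xx cx.
have [W W0 noball] := no_large_ball bX mX saf z0.
exists (W%:R * z); split; first exact: convex_subgroup_natmul.
  by rewrite mulr_gt0 // ltr0n.
move=> d' [[s [sinj _]] dmax].
have d'k : d' = k.
  apply/eqP; rewrite eqn_leq (leq_trans kd (dmax _ dS)) andbT.
  by have := leq_card s sinj; rewrite !card_ord.
(* The exceptional set is empty: an idempotent matrix of full rank is the identity, so the only
   [k]-plane is the whole space. *)
subst d'; exists set0; split=> //.
- exists [::]; apply/seteqP; split=> [x [P]|x] //.
- by move=> e [t [_ [u /interior_subset [_ [P []]]]]].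
move=> P [_ PP rP] _ [c [_ cball]]; apply: (noball c) => y yc.
have Pu : P \in unitmx by rewrite -row_full_unit /row_full rP.
have P1 : P = 1%:M by rewrite -[P](mulKmx Pu) PP mulVmx.
have [t [St tE]] := cball y ltac:(by rewrite P1 mulmx1) yc.
by rewrite -tE P1 mulmx1.
Qed.
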